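(* Let $X=W^{\alpha,\psi}_2(\Omega)$ and let $G:X\rightarrow\mathbb{R}^m$ satisfy: (A1) for every $\varepsilon>0$ there exists $M=M(\varepsilon)\in\mathbb{R}$ such that $\|G(u)\|_\Sigma\leqslant\exp(\varepsilon\|u\|_X^2+M)$ for all $u\in X$; (A2) for every $r>0$ there exists $K=K(r)>0$ such that $\|G(u_1)-G(u_2)\|_\Sigma\leqslant K\|u_1-u_2\|_X$ for all $u_1,u_2\in X$ with $\max\{\|u_1\|_X,\|u_2\|_X\}<r$. Let $\lambda>0$ and $R:X\to\mathbb{R}$, $R(u)=\lambda\int_a^b|D^{\alpha,\psi}_{[a,b]}u|\,dx$. For given $y\in\mathbb{R}^m$ let $\mu^y$ be given by $$\frac{d\mu^y}{d\mu_0}(u)\propto\exp(-\Phi^y(u)-R(u)),\qquad \Phi^y(u)=\tfrac12\|G(u)-y\|_\Sigma^2 .$$ Then: (i) $\mu^y$ is a well-defined probability measure on $X$. (ii) $\mu^y$ is Lipschitz in the data $y$ with respect to the Hellinger metric: if $\mu^y$ and $\mu^{y'}$ are the measures corresponding to data $y$ and $y'$ respectively, then for every $r>0$ there exists $C=C(r)>0$ such that for all $y,y'\in\mathbb{R}^m$ with $\max\{\|y\|_\Sigma,\|y'\|_\Sigma\}<r$, $$d_{Hell}(\mu^y,\mu^{y'})\leqslant C\|y-y'\|_\Sigma.$$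
   Context: $\Omega=[a,b]$ is a finite interval, $\alpha>0$ is real, $n=[\alpha]+1$, and $\psi\in C^n(\Omega)$ is increasing with $\psi'(x)\neq 0$ for all $x\in\Omega$. Functions are real-valued. Write $D_\psi=\frac{1}{\psi'(x)}\frac{d}{dx}$. For $\beta>0$ the fractional integrals with respect to $\psi$ are $$I^{\beta,\psi}_{[a,x]}f(x)=\frac{1}{\Gamma(\beta)}\int_a^x\frac{\psi'(t)f(t)\,dt}{(\psi(x)-\psi(t))^{1-\beta}},\qquad I^{\beta,\psi}_{[x,b]}f(x)=\frac{1}{\Gamma(\beta)}\int_x^b\frac{\psi'(t)f(t)\,dt}{(\psi(t)-\psi(x))^{1-\beta}}.$$ The left and right Riemann-Liouville derivatives with respect to $\psi$ are $D^{\alpha,\psi}_{[a,x]}f=D_\psi^n I^{n-\alpha,\psi}_{[a,x]}f$ and $D^{\alpha,\psi}_{[x,b]}f=(-D_\psi)^n I^{n-\alpha,\psi}_{[x,b]}f$, and the Riesz (Riemann-Liouville) fractional derivative is $$D^{\alpha,\psi}_{[a,b]}f=\tfrac12\left(D^{\alpha,\psi}_{[a,x]}f+(-1)^nD^{\alpha,\psi}_{[x,b]}f\right).$$ Test functions: $\mathcal{C}^n_0(\Omega,\mathbb{R})$ is the set of $g\in C^n(\Omega)$ with $D_\psi^i g=0$ at $a$ and at $b$ for all $i=0,1,\dots,n$. For $u\in L^2(\Omega)$, $D^{\alpha,\psi}_{[a,b]}u$ is understood in the weak sense: it is the function $v\in L^2(\Omega)$ (if it exists) such that $$\int_a^b\psi'\,u\,D^{\alpha,\psi}_{[a,b]}g\,dx=(-1)^n\int_a^b\psi'\,v\,g\,dx\quad\text{for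 all }g\in\mathcal{C}^n_0(\Omega,\mathbb{R}).$$ $X=W^{\alpha,\psi}_2(\Omega)$ is the set of $u\in L^2(\Omega)$ (modulo a.e. equality) for which $D^{\alpha,\psi}_{[a,b]}u\in L^2(\Omega)$ exists; it is a separable Hilbert space with inner product $$\langle u,v\rangle=\int_a^b uv\,dx+\int_a^b(D^{\alpha,\psi}_{[a,b]}u)(D^{\alpha,\psi}_{[a,b]}v)\,dx .$$ $\mu_0=\mathcal{N}(0,\mathcal{C}_0)$ is a Gaussian measure on $X$ with mean zero and symmetric positive trace-class covariance operator $\mathcal{C}_0$. $\Sigma$ is the (symmetric positive definite) $m\times m$ covariance matrix of the observation noise, and $\|z\|_\Sigma=\|\Sigma^{-1/2}z\|_2$ for $z\in\mathbb{R}^m$. The symbol $\propto$ means equality up to a normalization constant making $\mu^y$ a probability measure. The Hellinger metric between measures $\mu,\mu'$ both absolutely continuous with respect to a measure $\nu$ on $X$ is $$d_{Hell}(\mu,\mu')=\sqrt{\frac12\int_X\left(\sqrt{\frac{d\mu}{d\nu}}-\sqrt{\frac{d\mu'}{d\nu}}\right)^2d\nu}.$$ *)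

(* Defs.v *)
From HB Require Import structures.
From mathcomp Require Import all_boot all_order all_algebra.
From mathcomp Require Import generic_quotient ring_quotient.
From mathcomp Require Import all_classical all_reals all_analysis.

Set Implicit Arguments.
Unset Strict Implicit.
Unset Printing Implicit Defensive.

Import Order.TTheory GRing.Theory Num.Theory.
Import numFieldNormedType.Exports.

Local Open Scope classical_set_scope.
Local Open Scope charge_scope.
Local Open Scope ring_scope.

Section FractionalCalculus.
Context {R : realType}.
Implicit Types (a b alpha beta : R) (psi f g : R -> R).

Local Notation leb := (@lebesgue_measure R).

Definition Gamma (z : R) : R :=
  \int[leb]_(t in `]0, +oo[) (t `^ (z - 1) * expR (- t)).

(* The derivative of a function on [a, b]: the limits are taken inside [a, b],
   so they are two-sided in the interior and one-sided at a and b. *)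
Definition diff_quot a b f x :=
  (f y - f x) / (y - x) @[y --> within `[a, b] x^'].

Definition derivable_on a b f x : Prop := cvg (diff_quot a b f x).

Definition deriv_on a b f (x : R) : R := lim (diff_quot a b f x).

Definition Cn a b (n : nat) f : Prop :=
  (forall i x, (i < n)%N -> x \in `[a, b] ->
     derivable_on a b (iter i (deriv_on a b) f) x) /\
  {within `[a, b], continuous (iter n (deriv_on a b) f)}.

Definition Dpsi a b psi f (x : R) : R :=
  deriv_on a b f x / deriv_on a b psi x.

Definition frac_int_left a b psi beta f (x : R) : R :=
  (Gamma beta)^-1 * \int[leb]_(t in `[a, x])
    (deriv_on a b psi t * f t / (psi x - psi t) `^ (1 - beta)).

Definition frac_int_right a b psi beta f (x : R) : R :=
  (Gamma beta)^-1 * \int[leb]_(t in `[x, b])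
    (deriv_on a b psi t * f t / (psi t - psi x) `^ (1 - beta)).

Definition frac_order alpha : nat := (Num.truncn alpha).+1.

Definition RL_left a b alpha psi f : R -> R :=
  iter (frac_order alpha) (Dpsi a b psi)
    (frac_int_left a b psi ((frac_order alpha)%:R - alpha) f).

Definition RL_right a b alpha psi f : R -> R :=
  iter (frac_order alpha) (fun h x => - Dpsi a b psi h x)
    (frac_int_right a b psi ((frac_order alpha)%:R - alpha) f).

Definition riesz a b alpha psi f (x : R) : R :=
  2^-1 * (RL_left a b alpha psi f x
          + (-1) ^+ frac_order alpha * RL_right a b alpha psi f x).

Definition test_fun a b alpha psi g : Prop :=
  Cn a b (frac_order alpha) g /\
  forall i, (i <= frac_order alpha)%N ->
    iter i (Dpsi a b psi) g a = 0 /\ iter i (Dpsi a b psi) g b = 0.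

(* Lebesgue measure on [a, b]: for it, only the values on [a, b] of a function
   on R matter. *)
Definition leb_on a b : {measure set (measurableTypeR R) -> \bar R} :=
  mrestr leb (measurable_itv `[a, b]).

Definition L2 a b := LfunType (leb_on a b) (lee1n 2).

(* Integrability is part of the meaning of the equation: the real-valued
   integral of the library is total. *)
Definition weak_riesz a b alpha psi (u v : L2 a b) : Prop :=
  forall g, test_fun a b alpha psi g ->
    [/\ leb.-integrable `[a, b] (fun x =>
          (deriv_on a b psi x * u x * riesz a b alpha psi g x)%:E),
        leb.-integrable `[a, b] (fun x =>
          (deriv_on a b psi x * v x * g x)%:E) &
        \int[leb]_(x in `[a, b])
           (deriv_on a b psi x * u x * riesz a b alpha psi g x) =
        (-1) ^+ frac_order alpha *
        \int[leb]_(x in `[a, b]) (deriv_on a b psi x * v x * g x)].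

Definition has_weak_riesz a b alpha psi : {pred L2 a b} :=
  fun u => `[< exists v, weak_riesz alpha psi u v >].

Lemma weak_riesz_linear a b alpha psi (k : R) (u1 u2 v1 v2 : L2 a b) :
  weak_riesz alpha psi u1 v1 -> weak_riesz alpha psi u2 v2 ->
  weak_riesz alpha psi (k *: u1 + u2) (k *: v1 + v2).
Proof.
have lin (h w1 w2 : R -> R) :
    leb.-integrable `[a, b] (EFin \o (fun x => deriv_on a b psi x * w1 x * h x)) ->
    leb.-integrable `[a, b] (EFin \o (fun x => deriv_on a b psi x * w2 x * h x)) ->
    leb.-integrable `[a, b] (EFin \o
      (fun x => deriv_on a b psi x * (k * w1 x + w2 x) * h x)) /\
    \int[leb]_(x in `[a, b]) (deriv_on a b psi x * (k * w1 x + w2 x) * h x) =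
    k * \int[leb]_(x in `[a, b]) (deriv_on a b psi x * w1 x * h x)
      + \int[leb]_(x in `[a, b]) (deriv_on a b psi x * w2 x * h x).
  move=> i1 i2.
  have E : (fun x => deriv_on a b psi x * (k * w1 x + w2 x) * h x) =
      (fun x => k * (deriv_on a b psi x * w1 x * h x)
                + deriv_on a b psi x * w2 x * h x).
    by apply/funext => x; rewrite mulrDr mulrDl mulrCA !mulrA.
  rewrite E; move: i1 i2 => {E}.
  set F1 := fun x => deriv_on a b psi x * w1 x * h x.
  set F2 := fun x => deriv_on a b psi x * w2 x * h x.
  move=> i1 i2.
  have ik : leb.-integrable `[a, b] (EFin \o (fun x => k * F1 x)).
    by apply: (@integrableZl _ _ _ leb `[a, b] _ k (EFin \o F1)) => //; exact: measurable_itv.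
  split; last by rewrite RintegralD// RintegralZl.
  exact: (@integrableD _ _ _ leb _ (measurable_itv _) (EFin \o (fun x => k * F1 x)) (EFin \o F2)).
move=> H1 H2 g tg; have [i1 j1 e1] := H1 g tg; have [i2 j2 e2] := H2 g tg.
have [Iu Eu] := lin _ _ _ i1 i2; have [Iv Ev] := lin _ _ _ j1 j2.
split; [exact: Iu|exact: Iv|].
by rewrite [LHS]Eu [in RHS]Ev e1 e2 mulrDr mulrCA.
Qed.

Lemma has_weak_riesz_submod a b alpha psi :
  submod_closed (@has_weak_riesz a b alpha psi).
Proof.
split.
  apply/asboolP; exists 0 => g _.
  have E (h : R -> R) : (fun x => deriv_on a b psi x * (0 : L2 a b) x * h x) =
      cst 0.
    by apply/funext => x /=; rewrite mulr0 mul0r.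
  have I0 : leb.-integrable `[a, b] (EFin \o cst 0 : R -> \bar R).
    exact: integrable0.
  split; [by rewrite -[X in _.-integrable _ X]/(EFin \o _) E..|].
  by rewrite !E /Rintegral integral0 mulr0.
move=> k u1 u2 /asboolP[v1 h1] /asboolP[v2 h2].
by apply/asboolP; exists (k *: v1 + v2); exact: weak_riesz_linear.
Qed.

HB.instance Definition _ a b alpha psi :=
  GRing.isSubmodClosed.Build R (L2 a b) (@has_weak_riesz a b alpha psi)
    (@has_weak_riesz_submod a b alpha psi).

Record Wrep a b alpha psi := MkWrep {
  Wrep_fun :> L2 a b ;
  _ : has_weak_riesz alpha psi Wrep_fun }.

HB.instance Definition _ a b alpha psi :=
  [isSub for @Wrep_fun a b alpha psi].
HB.instance Definition _ a b alpha psi :=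
  [Choice of Wrep a b alpha psi by <:].
HB.instance Definition _ a b alpha psi :=
  [SubChoice_isSubLmodule of Wrep a b alpha psi by <:].

Definition Wnull a b alpha psi : {pred Wrep a b alpha psi} :=
  fun u => `[< Wrep_fun u = cst 0 %[ae leb_on a b] >].

Lemma Wnull_submod a b alpha psi : submod_closed (@Wnull a b alpha psi).
Proof.
split; first exact/asboolP/aeW.
move=> k u v /asboolP u0 /asboolP v0; apply/asboolP.
apply: filterS2 u0 v0 => x /(_ I) ux /(_ I) vx _.
change (k * Wrep_fun u x + Wrep_fun v x = 0).
by rewrite ux vx mulr0 addr0.
Qed.

HB.instance Definition _ a b alpha psi :=
  GRing.isSubmodClosed.Build R (Wrep a b alpha psi) (@Wnull a b alpha psi)
    (@Wnull_submod a b alpha psi).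

Definition W a b alpha psi := Quotient.quot (@Wnull a b alpha psi).

HB.instance Definition _ a b alpha psi := GRing.Zmodule.on (W a b alpha psi).

Definition Wclass a b alpha psi (u : Wrep a b alpha psi) : W a b alpha psi :=
  (\pi u)%qT.

Definition Wval a b alpha psi (u : W a b alpha psi) : Wrep a b alpha psi :=
  repr u.

Definition Wscale a b alpha psi (k : R) (u : W a b alpha psi) :=
  Wclass (k *: Wval u).

Lemma WvalK a b alpha psi : cancel (@Wval a b alpha psi) (@Wclass a b alpha psi).
Proof. by move=> u; rewrite /Wclass /Wval reprK. Qed.

Lemma eq_Wclass a b alpha psi (u v : Wrep a b alpha psi) :
  (Wclass u == Wclass v) = (u - v \in @Wnull a b alpha psi).
Proof. by rewrite Quotient.idealrBE. Qed.

Lemma WclassD a b alpha psi (u v : Wrep a b alpha psi) :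
  Wclass (u + v) = Wclass u + Wclass v.
Proof. exact: Quotient.pi_add. Qed.

Lemma WclassZ a b alpha psi k (u : Wrep a b alpha psi) :
  Wclass (k *: u) = Wscale k (Wclass u).
Proof.
apply/eqP; rewrite eq_Wclass -scalerBr rpredZ// -eq_Wclass WvalK.
exact: eqxx.
Qed.

Lemma WscaleA a b alpha psi k l (u : W a b alpha psi) :
  Wscale k (Wscale l u) = Wscale (k * l) u.
Proof. by rewrite -[u]WvalK -!WclassZ scalerA. Qed.

Lemma Wscale1 a b alpha psi : left_id 1 (@Wscale a b alpha psi).
Proof. by move=> u; rewrite -[u]WvalK -WclassZ scale1r. Qed.

Lemma WscaleDr a b alpha psi : right_distributive (@Wscale a b alpha psi) +%R.
Proof.
by move=> k u v; rewrite -[u]WvalK -[v]WvalK -WclassD -!WclassZ scalerDr WclassD.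
Qed.

Lemma WscaleDl a b alpha psi (u : W a b alpha psi) :
  {morph (@Wscale a b alpha psi)^~ u : k l / k + l}.
Proof.
by move=> k l; rewrite -[u]WvalK -!WclassZ scalerDl WclassD.
Qed.

HB.instance Definition _ a b alpha psi :=
  GRing.Zmodule_isLmodule.Build R (W a b alpha psi)
    (@WscaleA a b alpha psi) (@Wscale1 a b alpha psi)
    (@WscaleDr a b alpha psi) (@WscaleDl a b alpha psi).

(* Two weak derivatives of u agree almost everywhere (psi' does not vanish), so
   the choice made here does not matter. *)
Definition Driesz a b alpha psi (u : W a b alpha psi) : L2 a b :=
  xget 0 [set v | weak_riesz alpha psi (Wrep_fun (Wval u)) v].

Definition Wdot a b alpha psi (u v : W a b alpha psi) : R :=
  \int[leb]_(x in `[a, b]) (Wrep_fun (Wval u) x * Wrep_fun (Wval v) x)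
  + \int[leb]_(x in `[a, b]) (Driesz u x * Driesz v x).

Definition Wnorm a b alpha psi (u : W a b alpha psi) : R :=
  Num.sqrt (Wdot u u).

Definition Wopen a b alpha psi : set (set (W a b alpha psi)) :=
  [set A | forall u, A u ->
     exists2 e : R, 0 < e & forall v, Wnorm (v - u) < e -> A v].

HB.instance Definition _ a b alpha psi :=
  isPointed.Build (W a b alpha psi) 0.

HB.instance Definition _ a b alpha psi :=
  @isMeasurable.Build (sigma_display (@Wopen a b alpha psi))
    (W a b alpha psi) <<s @Wopen a b alpha psi >>
    (@sigma_algebra0 _ setT _) (@sigma_algebraC _ _)
    (@sigma_algebra_bigcup _ setT _).

(* With variance 0, [normal_prob] is not a point mass. *)
Definition centered_normal (v : R) : set (measurableTypeR R) -> \bar R :=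
  if v == 0 then dirac (0 : R) else normal_prob 0 (Num.sqrt v).

Definition orthonormal_basis a b alpha psi (e : nat -> W a b alpha psi) : Prop :=
  (forall i j, Wdot (e i) (e j) = (i == j)%:R) /\
  (forall u, (forall i, Wdot u (e i) = 0) -> u = 0).

Definition bounded_op a b alpha psi (T : W a b alpha psi -> W a b alpha psi) :=
  exists M : R, forall u, Wnorm (T u) <= M * Wnorm u.

Definition symmetric_op a b alpha psi (T : W a b alpha psi -> W a b alpha psi) :=
  forall u v, Wdot (T u) v = Wdot u (T v).

Definition positive_op a b alpha psi (T : W a b alpha psi -> W a b alpha psi) :=
  forall u, 0 <= Wdot (T u) u.

(* For positive T, where |T| = T; W is infinite-dimensional and separable, so
   its orthonormal bases are sequences. *)
Definition trace_class a b alpha psi (T : W a b alpha psi -> W a b alpha psi) :=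
  exists2 e, orthonormal_basis e &
    (\sum_(k <oo) (Wdot (T (e k)) (e k))%:E < +oo)%E.

(* N(0, T): every continuous linear functional <h, .> has the law
   N(0, <T h, h>). *)
Definition centered_gaussian a b alpha psi (mu : probability (W a b alpha psi) R)
    (T : W a b alpha psi -> W a b alpha psi) : Prop :=
  forall h (A : set (measurableTypeR R)), measurable A ->
    pushforward mu (Wdot h : W a b alpha psi -> measurableTypeR R) A =
    centered_normal (Wdot (T h) h) A.

Definition regularizer a b alpha psi (lambda : R) (u : W a b alpha psi) : R :=
  lambda * \int[leb]_(x in `[a, b]) `|Driesz u x|.

End FractionalCalculus.

Section Noise.
Context {R : realType} {m : nat}.
Implicit Types (A Sigma : 'M[R]_m) (z : 'cV[R]_m).

Definition sym_posdef A : Prop :=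
  A^T = A /\ forall z, z != 0 -> 0 < (z^T *m A *m z) 0 0.

Definition norm2 z : R := Num.sqrt (\sum_i z i 0 ^+ 2).

(* Unique when A is symmetric positive definite. *)
Definition sqrt_mx A : 'M[R]_m :=
  xget 0 [set S | sym_posdef S /\ S *m S = A].

Definition normS Sigma z : R := norm2 (sqrt_mx (invmx Sigma) *m z).

Definition misfit (X : Type) Sigma (G : X -> 'cV[R]_m) (y : 'cV[R]_m) (u : X) : R :=
  2^-1 * normS Sigma (G u - y) ^+ 2.

End Noise.

Section Posterior.
Context {d : measure_display} {X : measurableType d} {R : realType}.

Definition gibbs (mu0 : probability X R) (V : X -> R) (P : probability X R) : Prop :=
  P `<< mu0 /\
  exists2 c : R, 0 < c &
    'd (charge_of_finite_measure P) '/d mu0 = (fun u => (c * expR (- V u))%:E)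
      %[ae mu0].

Definition hellinger (nu : {sigma_finite_measure set X -> \bar R})
    (P Q : probability X R) : R :=
  Num.sqrt (2^-1 * \int[nu]_u
    (Num.sqrt (fine ('d (charge_of_finite_measure P) '/d nu u))
     - Num.sqrt (fine ('d (charge_of_finite_measure Q) '/d nu u))) ^+ 2).

End Posterior.

(* Main.v *)
From HB Require Import structures.
Require Import Defs.
From mathcomp Require Import all_boot all_order all_algebra.
From mathcomp Require Import all_classical all_reals all_analysis.
From mathcomp Require Import measurable_realfun.
From mathcomp Require Import ring lra.
Import Order.TTheory GRing.Theory Num.Theory.
Import numFieldNormedType.Exports.
Local Open Scope classical_set_scope.
Local Open Scope ring_scope.

Set Implicit Arguments.
Unset Strict Implicit.
Unset Printing Implicit Defensive.

(** Write V_y for the potential, s_y(u) = |G(u) - y|_Sigma and R for the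
regularizer, so that V_y = s_y^2 / 2 + R is nonnegative.

Well-posedness.  Once V_y is measurable, exp(-V_y) takes its values in ]0, 1],
so its integral Z_y against the probability mu0 lies in ]0, 1]: dividing by
Z_y gives the density of a probability measure, and a measure is determined by
its density (gibbs_exists, gibbs_unique).

Measurability.  V_y is continuous for the norm of W.  For s_y this is the
local Lipschitz assumption on G and the triangle inequality
(Wcontinuous_of_lipschitz).  For R, the Cauchy-Schwarz inequality bounds
|R(v) - R(u)| by the L2 norm of D(v - u), D being the weak Riesz derivative,
provided that D is additive (regularizer_continuous).  Now D u is chosen among
all weak derivatives of a chosen representative of u, so additivity rests on
the uniqueness of weak derivatives almost everywhere (weak_riesz_unique), that
is, on the fundamental lemma of the calculus of variations for the available
test functions.  These contain the functions p(psi(x)), p a polynomial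
vanishing to order n + 1 at psi(a) and psi(b) (poly_test_fun).  The polynomials
(1 - t^k)^[c^-k] stay in [0, 1] on [0, 1] and converge to the indicator of
[0, c[ away from c; so a function F all of whose integrals against q(psi), q a
polynomial, vanish has, by dominated convergence, a vanishing primitive, and
is therefore zero almost everywhere (ae_eq0_of_poly_moments).

Lipschitz dependence on the data.  The density of mu^y is exp(-V_y) / Z_y, whose
square root involves exp(-V_y / 2) = exp(-s_y^2 / 4 - R / 2).  The function
s |-> exp(-s^2 / 4) has a bounded derivative, with a bound at most 1; hence
y |-> exp(-V_y(u) / 2) is 1-Lipschitz for |.|_Sigma, uniformly in u
(half_gaussian_lipschitz).  As s_y^2 / 2 <= |G|_Sigma^2 + r^2 when
|y|_Sigma < r, the constants Z_y are bounded below by the positive integral of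
exp(-|G|_Sigma^2 - r^2 - R).  Together these bound the difference of the
square roots of the two densities by a multiple of |y - y'|_Sigma, uniformly in
u (sqrt_partition_dist), and it remains to integrate a constant against a
probability.  A measure nu dominating mu^y dominates mu0, because the density
of mu^y is positive, so the densities with respect to nu are those with
respect to mu0 multiplied by d mu0 / d nu (hellinger_gibbs_le). *)

(** * Differentiation on a closed interval *)

Section Derivation.
Context {R : realType} (a b : R) (ab : a < b).
Implicit Types (f g h : R -> R) (x l : R) (p q : {poly R}).

Local Notation dq := (diff_quot a b).
Local Notation D := (deriv_on a b).

(** The filter along which the difference quotients are taken is proper, also at
    the endpoints: this makes their limits unique. *)
Lemma punctured_itv_proper x : x \in `[a, b] ->
  ProperFilter (within `[a, b] x^').
Proof.
move=> xab; apply: Build_ProperFilter_ex => P.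
rewrite /within /= /dnbhs /within /= => /nbhs_ballP[e /= e0 He].
move: xab; rewrite in_itv /= => /andP[ax xb].
have [xlb|bx] := ltP x b.
  pose y := x + Num.min (e / 2) (b - x).
  have m0 : 0 < Num.min (e / 2) (b - x) by rewrite lt_min divr_gt0 //= subr_gt0.
  have mle : Num.min (e / 2) (b - x) <= b - x by rewrite ge_min lexx orbT.
  have mlt : Num.min (e / 2) (b - x) < e.
    by rewrite gt_min; apply/orP; left; lra.
  exists y; apply: He.
  - by rewrite /ball /= /y opprD addNKr normrN gtr0_norm.
  - by rewrite /y -subr_eq0 addrC addKr gt_eqF.
  - by rewrite /= in_itv /= /y; apply/andP; split; lra.
have xb' : x = b by apply/eqP; rewrite eq_le xb bx.
pose y := x - Num.min (e / 2) (x - a).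
have m0 : 0 < Num.min (e / 2) (x - a) by rewrite lt_min divr_gt0 //= subr_gt0 xb'.
have mle : Num.min (e / 2) (x - a) <= x - a by rewrite ge_min lexx orbT.
have mlt : Num.min (e / 2) (x - a) < e.
  by rewrite gt_min; apply/orP; left; lra.
exists y; apply: He.
- by rewrite /ball /= /y opprB addrC subrK gtr0_norm.
- by rewrite /y -subr_eq0 addrC addKr oppr_eq0 gt_eqF.
- by rewrite /= in_itv /= /y; apply/andP; split; lra.
Qed.

Lemma deriv_onP f x : derivable_on a b f x -> dq f x --> D f x.
Proof. by []. Qed.

Lemma deriv_on_eq f x l : x \in `[a, b] -> dq f x --> l -> D f x = l.
Proof. by move=> /punctured_itv_proper F fl; apply: cvg_lim. Qed.

Lemma near_punctured_itv x (P : set R) : (forall y, y \in `[a, b] -> y != x -> P y) ->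
  \forall y \near within `[a, b] x^', P y.
Proof.
move=> H; by rewrite /dnbhs !near_withinE; apply: nearW => y yx yab; exact: H.
Qed.

Lemma diff_quot_congr f g x l : x \in `[a, b] -> {in `[a, b], f =1 g} ->
  dq f x --> l -> dq g x --> l.
Proof.
move=> xab fg; apply: cvg_trans; apply: near_eq_cvg.
by apply: near_punctured_itv => y yab _; rewrite !fg.
Qed.

Lemma derivable_on_congr f g x : x \in `[a, b] -> {in `[a, b], f =1 g} ->
  derivable_on a b f x -> derivable_on a b g x.
Proof. by move=> xab fg df; apply/cvg_ex; exists (D f x); apply: diff_quot_congr df. Qed.

(** No derivability is assumed: functions equal on [a, b] have the same filter of
    difference quotients, so even an undefined limit takes the same value. *)
Lemma deriv_on_congr f g : {in `[a, b], f =1 g} -> {in `[a, b], D f =1 D g}.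
Proof.
move=> fg x xab; rewrite /deriv_on.
suff -> : dq f x = dq g x by [].
have sub u v : {in `[a, b], u =1 v} -> dq v x `<=` dq u x.
  move=> uv A HA.
  have E : \forall y \near within `[a, b] x^',
      (u y - u x) / (y - x) = (v y - v x) / (y - x).
    by apply: near_punctured_itv => y yab _; rewrite !uv.
  by apply: filterS2 E HA => y /= ->.
by apply/seteqP; split; apply: sub => // y yab; rewrite fg.
Qed.

Lemma diff_quot_continuous f x l : dq f x --> l ->
  f y @[y --> within `[a, b] x^'] --> f x.
Proof.
move=> fl.
have H : (f x + (f y - f x) / (y - x) * (y - x)) @[y --> within `[a, b] x^'] --> f x + l * (x - x).
  apply: cvgD; first exact: cvg_cst.
  apply: cvgM => //; apply: cvgB; last exact: cvg_cst.
  have : x^' --> x by exact: cvg_within.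
  by apply: cvg_trans; apply: cvg_within.
move: H; rewrite subrr mulr0 addr0; apply: cvg_trans; apply: near_eq_cvg.
apply: near_punctured_itv => y _ yx; rewrite mulfVK ?subr_eq0//; ring.
Qed.

Lemma derivable_on_continuous f : (forall x, x \in `[a, b] -> derivable_on a b f x) ->
  {within `[a, b], continuous f}.
Proof.
move=> df; apply/subspace_continuousP => x xab.
have /diff_quot_continuous fx := df x xab.
move=> U Ux; have : \forall y \near within `[a, b] x^', U (f y) := fx U Ux.
suff : (\forall y \near within `[a, b] x^', U (f y)) ->
    \forall y \near within `[a, b] (nbhs x), U (f y) by [].
rewrite /dnbhs !near_withinE.
apply: filterS => y H yab; have [->|/H] := eqVneq y x; last exact.
exact: nbhs_singleton.
Qed.

Lemma diff_quot_cst k x : dq (cst k) x --> 0.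
Proof.
rewrite /diff_quot /cst /=; under eq_fun do rewrite subrr mul0r; exact: cvg_cst.
Qed.

Lemma diff_quotD f g x (k l : R) : dq f x --> k -> dq g x --> l ->
  dq (f \+ g) x --> k + l.
Proof.
move=> fk gl.
have H : ((f y - f x) / (y - x) + (g y - g x) / (y - x))
    @[y --> within `[a, b] x^'] --> k + l by apply: cvgD.
move: H; apply: cvg_trans; apply: near_eq_cvg.
by apply: near_punctured_itv => y _ _ /=; ring.
Qed.

Lemma diff_quotM f g x (k l : R) : dq f x --> k -> dq g x --> l ->
  dq (f \* g) x --> k * g x + f x * l.
Proof.
move=> fk gl.
have gx := diff_quot_continuous gl.
have H : ((f y - f x) / (y - x) * g y + f x * ((g y - g x) / (y - x)))
    @[y --> within `[a, b] x^'] --> k * g x + f x * l.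
  by apply: cvgD; apply: cvgM => //; exact: cvg_cst.
move: H; apply: cvg_trans; apply: near_eq_cvg.
by apply: near_punctured_itv => y _ _ /=; ring.
Qed.

(** The chain rule for a polynomial follows from the sum and product rules alone,
    by induction on the polynomial. *)
Lemma diff_quot_horner f x l p : dq f x --> l ->
  dq (fun y => p.[f y]) x --> p^`().[f x] * l.
Proof.
move=> fl; elim/poly_ind: p => [|p c IH].
  under eq_fun do rewrite horner0; rewrite deriv0 horner0 mul0r; exact: diff_quot_cst.
have -> : (fun y => (p * 'X + c%:P).[f y]) = ((fun y => p.[f y]) \* f) \+ cst c.
  by apply/funext => y; rewrite !hornerE.
have := diff_quotD (diff_quotM IH fl) (diff_quot_cst c x).
suff -> : (p * 'X + c%:P)^`().[f x] * l = p^`().[f x] * l * f x + p.[f x] * l + 0 by [].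
rewrite derivD derivM derivX derivC !hornerE. ring.
Qed.

Lemma Cn_congr k f g : {in `[a, b], f =1 g} -> Cn a b k f -> Cn a b k g.
Proof.
move=> fg [df cf].
have fgi i : {in `[a, b], iter i D f =1 iter i D g}.
  by elim: i => //= i IH; apply: deriv_on_congr.
split=> [i x ik xab|].
  exact: derivable_on_congr (fgi i) (df i x ik xab).
apply: subspace_eq_continuous cf => x; rewrite inE; exact: fgi.
Qed.

(** Peeling off the innermost derivative rather than the outermost one: in this
    form the class is stable under products by induction on k. *)
Lemma CnS k f : Cn a b k.+1 f <->
  (forall x, x \in `[a, b] -> derivable_on a b f x) /\ Cn a b k (D f).
Proof.
split=> [[df cf]|[df [dDf cDf]]].
  split; first by move=> x; apply: (df 0%N).
  split=> [i x ik|]; last by rewrite -iterSr.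
  by rewrite -iterSr; apply: df.
split; last by rewrite iterSr.
by case=> [|i] x ik xab; [exact: df|rewrite iterSr; exact: dDf].
Qed.

Lemma Cn_weak k f : Cn a b k.+1 f -> Cn a b k f.
Proof.
elim: k f => [|k IH] f /CnS[df Df]; last by apply/CnS; split => //; exact: IH.
by split => //; exact: derivable_on_continuous.
Qed.

Lemma Cn_derivable k f x : (0 < k)%N -> Cn a b k f -> x \in `[a, b] ->
  derivable_on a b f x.
Proof. by move=> k0 [df _]; apply: (df 0%N). Qed.

Lemma Cn_cst k c : Cn a b k (cst c).
Proof.
elim: k c => [|k IH] c; first by split => //=; exact: cst_continuous.
apply/CnS; split=> [x xab|]; first by apply/cvg_ex; exists 0; exact: diff_quot_cst.
apply: (@Cn_congr _ (cst 0)) => // x xab.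
exact/esym/deriv_on_eq/diff_quot_cst.
Qed.

Lemma CnD k f g : Cn a b k f -> Cn a b k g -> Cn a b k (f \+ g).
Proof.
elim: k f g => [|k IH] f g.
  by move=> [_ cf] [_ cg]; split => //= x; apply: cvgD; [exact: cf|exact: cg].
move=> /CnS[df Df] /CnS[dg Dg].
have dfg x (xab : x \in `[a, b]) := diff_quotD (df x xab) (dg x xab).
apply/CnS; split=> [x xab|]; first by apply/cvg_ex; eexists; exact: dfg.
apply: Cn_congr (IH _ _ Df Dg) => x xab.
by apply/esym/deriv_on_eq => //; exact: dfg.
Qed.

Lemma CnM k f g : Cn a b k f -> Cn a b k g -> Cn a b k (f \* g).
Proof.
elim: k f g => [|k IH] f g.
  by move=> [_ cf] [_ cg]; split => //= x; apply: cvgM; [exact: cf|exact: cg].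
move=> Cf Cg; have [df Df] := (CnS k f).1 Cf; have [dg Dg] := (CnS k g).1 Cg.
have dfg x (xab : x \in `[a, b]) := diff_quotM (df x xab) (dg x xab).
apply/CnS; split=> [x xab|]; first by apply/cvg_ex; eexists; exact: dfg.
apply: Cn_congr (CnD (IH _ _ Df (Cn_weak Cg)) (IH _ _ (Cn_weak Cf) Dg)) => x xab.
by apply/esym/deriv_on_eq => //; exact: dfg.
Qed.

Lemma Cn_horner k f p : Cn a b k f -> Cn a b k (fun x => p.[f x]).
Proof.
move=> Cf; elim/poly_ind: p => [|p c IH].
  by under eq_fun do rewrite horner0; exact: Cn_cst.
under eq_fun do rewrite hornerMXaddC.
exact: CnD (CnM IH Cf) (Cn_cst k c).
Qed.

Context (psi : R -> R).
Hypothesis dpsi : forall x, x \in `[a, b] -> derivable_on a b psi x.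
Hypothesis psi'0 : forall x, x \in `[a, b] -> D psi x != 0.

(** In the variable psi(x), the operator D_psi is plain differentiation: by the
    chain rule the factor psi' cancels. *)
Lemma iter_Dpsi_horner i p :
  {in `[a, b], iter i (Dpsi a b psi) (fun x => p.[psi x]) =1 (fun x => p^`(i).[psi x])}.
Proof.
elim: i => [|i IH] x xab; first by rewrite derivn0.
rewrite iterS /Dpsi (deriv_on_congr IH)// derivnS.
rewrite (deriv_on_eq xab (diff_quot_horner (deriv_onP (dpsi xab)))) mulfK//.
exact: psi'0.
Qed.

End Derivation.

(** A zero of order n is a zero of all derivatives of order less than n. *)
Lemma horner_derivn_factor (R : comNzRingType) (c : R) (q : {poly R}) n i :
  (i < n)%N -> (('X - c%:P) ^+ n * q)^`(i).[c] = 0.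
Proof.
elim: n i q => // n IH [|i] q ni.
  by rewrite derivn0 hornerM horner_exp !hornerE subrr expr0n /= mul0r.
rewrite derivSn derivM deriv_exp derivXsubC mul1r.
have -> : (('X - c%:P) ^+ n *+ n.+1) * q + ('X - c%:P) ^+ n.+1 * q^`() =
  ('X - c%:P) ^+ n * (q *+ n.+1 + ('X - c%:P) * q^`()).
  by rewrite exprS; ring.
exact: IH.
Qed.

(** * Polynomials approximating a step, and vanishing moments *)

Section StepPolynomials.
Context {R : realType}.
Implicit Types (c s t : R) (k n : nat).

(** Polynomial approximations of the indicator of [0, c[ on [0, 1]: the exponent,
    close to c^-k, makes the product of the exponent and s^k tend to 0 when s < c
    and to +oo when s > c. *)
Definition step_poly c k : {poly R} := (1 - 'X^k) ^+ Num.truncn (c ^- k).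

Lemma bernoulli_ineq t n : -1 <= t -> 1 + n%:R * t <= (1 + t) ^+ n.
Proof.
move=> t1; elim: n => [|n IH]; first by rewrite mul0r addr0 expr0.
have t0 : 0 <= 1 + t by lra.
rewrite exprS; apply: le_trans (ler_wpM2l t0 IH).
have : 0 <= n%:R * (t ^+ 2) by rewrite mulr_ge0 // sqr_ge0.
rewrite -natr1; nra.
Qed.

Lemma horner_step_poly c k s :
  (step_poly c k).[s] = (1 - s ^+ k) ^+ Num.truncn (c ^- k).
Proof. by rewrite /step_poly horner_exp !hornerE. Qed.

Lemma step_poly_itv c k s : 0 <= s <= 1 -> 0 <= (step_poly c k).[s] <= 1.
Proof.
move=> /andP[s0 s1]; rewrite horner_step_poly.
have sk0 : 0 <= s ^+ k by rewrite exprn_ge0.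
have sk1 : s ^+ k <= 1 by rewrite exprn_ile1.
by rewrite exprn_ge0 ?exprn_ile1//; lra.
Qed.

(** By Bernoulli's inequality the value at s is at least 1 - (s / c)^k. *)
Lemma step_poly_below c s : 0 < c < 1 -> 0 <= s < c ->
  (step_poly c k).[s] @[k --> \oo] --> (1 : R).
Proof.
move=> /andP[c0 c1] /andP[s0 sc].
have H : 1 - (s / c) ^+ k @[k --> \oo] --> (1 - 0 : R).
  apply: cvgB; first exact: cvg_cst.
  by apply: cvg_expr; rewrite ger0_norm ?divr_ge0 ?(ltW c0)// ltr_pdivrMr ?mul1r.
rewrite subr0 in H.
apply: (@squeeze_cvgr _ _ _ _ (fun k => 1 - (s / c) ^+ k) (cst 1)) => //; last exact: cvg_cst.
apply: nearW => k; apply/andP; split; last first.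
  by have /andP[] := step_poly_itv c k (s := s) ltac:(lra).
have sk0 : 0 <= s ^+ k by rewrite exprn_ge0.
have sk1 : s ^+ k <= 1 by rewrite exprn_ile1 //; lra.
rewrite horner_step_poly.
apply: (@le_trans _ _ (1 + (Num.truncn (c ^- k))%:R * (- s ^+ k))); last first.
  by apply: bernoulli_ineq; lra.
rewrite mulrN lerD2l lerN2 expr_div_n mulrC ler_wpM2l//.
by rewrite truncn_le // invr_ge0 exprn_ge0 // ltW.
Qed.

(** With t = s^k and M the exponent, (1 - t)^M (1 + t)^M <= 1 and
    (1 + t)^M >= 1 + M t >= (s / c)^k bound the value at s by (c / s)^k. *)
Lemma step_poly_above c s : 0 < c -> c < s <= 1 ->
  (step_poly c k).[s] @[k --> \oo] --> (0 : R).
Proof.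
move=> c0 /andP[cs s1]; have s0 : 0 < s by lra.
have H : (c / s) ^+ k @[k --> \oo] --> (0 : R).
  by apply: cvg_expr; rewrite ger0_norm ?divr_ge0 ?ltW// ltr_pdivrMr ?mul1r.
apply: (@squeeze_cvgr _ _ _ _ (cst 0) (fun k => (c / s) ^+ k)) => //; last exact: cvg_cst.
apply: nearW => k; apply/andP; split.
  by have /andP[] := step_poly_itv c k (s := s) ltac:(lra).
have sk0 : 0 < s ^+ k by rewrite exprn_gt0.
have sk1 : s ^+ k <= 1 by rewrite exprn_ile1 //; lra.
rewrite horner_step_poly; set M := Num.truncn _; set t := s ^+ k in sk0 sk1 *.
have Mt : 1 + M%:R * t <= (1 + t) ^+ M by apply: bernoulli_ineq; lra.
have prod1 : (1 - t) ^+ M * (1 + t) ^+ M <= 1.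
  by rewrite -exprMn exprn_ile1 //; nra.
have ck0 : 0 < c ^+ k by rewrite exprn_gt0.
(* Truncation loses less than 1, which the summand 1 of 1 + M t makes up for,
   since t <= 1. *)
have Mc : c ^- k < M%:R + 1.
  have := truncnS_gt (c ^- k); rewrite -natr1; exact.
rewrite expr_div_n -/t ler_pdivlMr//.
have p0 : 0 <= (1 - t) ^+ M by apply: exprn_ge0; lra.
have h1 : (1 - t) ^+ M * (t * c ^- k) <= 1.
  apply: le_trans prod1; apply: ler_wpM2l => //; apply: le_trans Mt.
  nra.
by rewrite -[leRHS]mul1r -ler_pdivrMr// -mulrA.
Qed.

End StepPolynomials.

Section VanishingIntegrals.
Context {R : realType}.
Local Notation leb := (@lebesgue_measure R).
Implicit Types (a b c x : R) (F psi : R -> R).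

(** The primitive of F is constant, and its derivative is F almost everywhere by
    Lebesgue's differentiation theorem. *)
Lemma ae_eq0_of_itv_integral a b F :
  leb.-integrable `[a, b] (EFin \o F) ->
  (forall c, a < c < b -> \int[leb]_(x in `[a, c]) F x = 0) ->
  {ae leb, forall x, a < x < b -> F x = 0}.
Proof.
move=> iF F0; pose f := F \_ `[a, b].
have locf : locally_integrable [set: R] f by exact: integrable_locally.
have intf y : leb.-integrable `[a, y] (EFin \o f).
  apply: (@integrableS _ _ _ leb setT) => //.
  by rewrite /f -restrict_EFin; apply/integrable_restrict; rewrite ?setTI.
have := @FTC1 R f (BLeft a) intf locf.
apply: filterS; first exact: (ae_filter_ringOfSetsType leb).
move=> x H /andP[ax xb].
have [_] := H ltac:(by rewrite lte_fin).
have -> : f x = F x by rewrite /f patchE mem_set //= in_itv /= !ltW.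
move=> <-; rewrite derive1E.
pose I := fun y : R => \int[leb]_(t in `[a, y]) f t.
have HI : {near x, (cst 0 : R -> R) =1 I}.
  have : \forall y \near x, y \in `]a, b[.
    by apply: near_in_itvoo; rewrite in_itv /= ax.
  apply: filterS => y; rewrite in_itv /= => /andP[ay yb]; rewrite /I /cst.
  rewrite -(F0 y) ?ay//; apply: eq_Rintegral => t; rewrite inE /= in_itv /= => /andP[at_ ty].
  by rewrite /f patchE mem_set //= in_itv /= at_ (le_trans ty)// ltW.
by rewrite -(near_eq_derive _ HI) derive_cst.
Qed.

(** The step polynomials, composed with the affine function S that maps psi(a) to 0
    and psi(b) to 1, turn the hypothesis into the vanishing of the integrals of F
    over [a, c]; monotonicity of psi makes psi(x) < psi(c) the same as x < c. *)
Lemma ae_eq0_of_poly_moments a b psi F :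
  a < b ->
  {in `[a, b] &, {homo psi : x y / x < y}} ->
  (forall q : {poly R}, leb.-integrable `[a, b] (EFin \o (fun x => F x * q.[psi x])) /\
     \int[leb]_(x in `[a, b]) (F x * q.[psi x]) = 0) ->
  {ae leb, forall x, a < x < b -> F x = 0}.
Proof.
move=> ab psim HF.
have iF : leb.-integrable `[a, b] (EFin \o F).
  have [+ _] := HF 1; apply: eq_integrable => // x _ /=.
  by rewrite hornerC mulr1.
apply: (ae_eq0_of_itv_integral iF) => c /andP[ac cb].
have aab : a \in `[a, b] by rewrite in_itv /= lexx ltW.
have bab : b \in `[a, b] by rewrite in_itv /= lexx ltW.
have cab : c \in `[a, b] by rewrite in_itv /= !ltW.
pose L := psi b - psi a.
have L0 : 0 < L by rewrite subr_gt0; apply: psim.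
pose s x := (psi x - psi a) / L.
have smono x y : x \in `[a, b] -> y \in `[a, b] -> x < y -> s x < s y.
  move=> xab yab xy; rewrite /s ltr_pM2r ?invr_gt0// ltrD2r.
  exact: psim.
have sa : s a = 0 by rewrite /s subrr mul0r.
have sb : s b = 1 by rewrite /s divff// gt_eqF.
have s01 x : x \in `[a, b] -> 0 <= s x <= 1.
  move=> xab; move: (xab); rewrite in_itv /= => /andP[].
  rewrite le_eqVlt => /predU1P[<- _|ax]; first by rewrite sa lexx ler01.
  rewrite le_eqVlt => /predU1P[->|xb]; first by rewrite sb lexx ler01.
  by rewrite -sa -sb !ltW// smono.
have c01 : 0 < s c < 1 by rewrite -sa -sb !smono.
pose S : {poly R} := L^-1 *: ('X - (psi a)%:P).
have SE x : S.[psi x] = s x by rewrite /S hornerZ hornerXsubC mulrC.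
pose q k := step_poly (s c) k \Po S.
have qE k x : (q k).[psi x] = (step_poly (s c) k).[s x] by rewrite horner_comp SE.
have mF : measurable_fun `[a, b] F.
  by apply/measurable_EFinP; case/integrableP: iF.
pose f_ k x := (F x * (q k).[psi x])%:E.
pose f x := (F x * \1_(`[a, c]) x)%:E.
have := @dominated_convergence _ _ _ leb `[a, b] (measurable_itv _) f_ f
  (fun x => `|F x|%:E).
case.
- by move=> k; case/integrableP: (HF (q k)).1.
- apply/measurable_EFinP; exact: measurable_funM.
- exists [set c]; split => //; first exact: lebesgue_measure_set1.
  move=> x /=; apply: contra_notP => /eqP xc /[!in_itv] /= /andP[ax xb].
  have xab : x \in `[a, b] by rewrite in_itv /= ax xb.
  rewrite /f_ /f; apply: cvg_EFin; first exact: nearW.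
  rewrite /=; apply: cvgM; first exact: cvg_cst.
  under eq_fun do rewrite /= qE.
  have [xltc|cx] := ltP x c.
    rewrite indicE mem_set /=; last by rewrite in_itv /= ax ltW.
    apply: step_poly_below => //.
    by have /andP[-> _] := s01 x xab; rewrite smono.
  have cltx : c < x by rewrite lt_neqAle eq_sym xc.
  rewrite indicE memNset /=; last by rewrite in_itv /= ax /=; apply/negP; rewrite -ltNge.
  apply: step_poly_above; first by case/andP: c01.
  by have /andP[_ ->] := s01 x xab; rewrite smono.
- exact: (integrable_abse iF).
- apply: aeW => x k /= xab; rewrite /f_ lee_fin normrM ler_piMr//.
  have /andP[q0 q1] := step_poly_itv (s c) k (s01 x xab).
  by rewrite qE ger0_norm.
move=> intf _ lim_f.
have f0 : (\int[leb]_(x in `[a, b]) f x = 0)%E.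
  apply/esym/(cvg_unique _ _ lim_f) => //.
  rewrite (_ : (fun n => _) = cst 0%E); first exact: cvg_cst.
  apply/funext => k; have [ik] := HF (q k).
  rewrite /Rintegral => Hk.
  have fin : (\int[leb]_(x in `[a, b]) (F x * (q k).[psi x])%:E)%E \is a fin_num.
    by apply: (@integrable_fin_num _ _ _ leb _ _ _ ik); exact: measurable_itv.
  by rewrite /= -[LHS](fineK fin) Hk.
rewrite -[RHS]/(fine 0%E) -f0; congr fine.
rewrite [RHS](_ : _ = \int[leb]_(x in `[a, b]) ((EFin \o F) \_ `[a, c]) x)%E; last first.
  apply: eq_integral => x _; rewrite /f patchE indicE /=.
  by case: ifPn => _; rewrite ?mulr1 ?mulr0.
rewrite -integral_mkcondr; congr integral.
apply/seteqP; split => x /=; last by case.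
rewrite !in_itv /= => /andP[ax xc]; split; last by rewrite ax.
by rewrite ax (le_trans xc)// ltW.
Qed.

End VanishingIntegrals.

(** * Square-integrable functions on [a, b] *)

Section RestrictedLebesgue.
Context {R : realType} (a b : R).
Local Notation leb := (@lebesgue_measure R).
Local Notation ae P := {ae leb, forall x, `[a, b]%classic x -> P x}.

Lemma ae_leb_on (P : R -> Prop) :
  {ae leb_on a b, forall x, P x} -> {ae leb, forall x, `[a, b]%classic x -> P x}.
Proof.
move=> [N [mN N0 sub]]; exists (N `&` `[a, b]%classic); split => //.
  by apply: measurableI => //; exact: measurable_itv.
move=> x /= /not_implyP[xab nP]; split => //; exact: sub.
Qed.

Lemma ae_eq_Rintegral (D : set R) (f g : R -> R) : measurable D ->
  measurable_fun D f -> measurable_fun D g ->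
  {ae leb, forall x, D x -> f x = g x} ->
  \int[leb]_(x in D) f x = \int[leb]_(x in D) g x.
Proof.
move=> mD mf mg [N [mN N0 sub]]; congr fine; apply: ae_eq_integral => //.
- exact/measurable_EFinP.
- exact/measurable_EFinP.
- exists N; split => // x /= H; apply: sub => /= fg; apply: H => Dx.
  by rewrite fg.
Qed.

Implicit Types u v w : L2 a b.

Lemma measurable_L2 u (D : set R) : measurable_fun D u.
Proof.
apply: measurable_funTS; have := LfunP u; rewrite inE => /andP[+ _].
by rewrite inE.
Qed.

Lemma integrable_leb_on (f : R -> R) :
  (leb_on a b).-integrable setT (EFin \o f) -> leb.-integrable `[a, b] (EFin \o f).
Proof.
move=> intf.
have : (leb_on a b).-integrable `[a, b] (EFin \o f).
  by apply: integrableS intf => //; exact: measurable_itv.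
move=> /integrableP[mf fin]; apply/integrableP; split => //.
rewrite (eq_measure_integral (leb_on a b)) // => A mA sub.
by rewrite /leb_on /= /mrestr setIidl.
Qed.

Lemma L2_mul_integrable u v : leb.-integrable `[a, b] (EFin \o (fun x => u x * v x)).
Proof.
apply: integrable_leb_on; apply/Lfun1_integrable.
by apply: Lfun2_mul_Lfun1; exact: LfunP.
Qed.

Lemma leb_on_fin : leb_on a b setT \is a fin_num.
Proof.
rewrite /leb_on /= /mrestr setTI lebesgue_measure_itv.
by case: ifP.
Qed.

Lemma L2_integrable u : leb.-integrable `[a, b] (EFin \o u).
Proof.
apply: integrable_leb_on; apply/Lfun1_integrable.
by apply: (Lfun_subset12 leb_on_fin); exact: LfunP.
Qed.

(** Integrated form of (v + w)^2 <= 2 v^2 + 2 w^2, a substitute for the triangle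
    inequality that needs no square roots. *)
Lemma L2_sum_sqr_le u v w :
  ae (fun x => u x = v x + w x) ->
  \int[leb]_(x in `[a, b]) (u x * u x) <=
  2 * \int[leb]_(x in `[a, b]) (v x * v x) + 2 * \int[leb]_(x in `[a, b]) (w x * w x).
Proof.
move=> E; have mI := measurable_itv `[a, b] : measurable (`[a, b]%classic : set (measurableTypeR R)).
have iz (z : L2 a b) : leb.-integrable `[a, b] (EFin \o (fun x => 2 * (z x * z x))) by
  apply: (@integrableZl _ _ _ leb _ mI 2 (EFin \o (fun x => z x * z x))); exact: L2_mul_integrable.
rewrite -!RintegralZl//; try exact: L2_mul_integrable.
rewrite -RintegralD//.
have ivw : leb.-integrable `[a, b] (EFin \o (fun x => (v + w) x * (v + w) x)).
  exact: L2_mul_integrable.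
rewrite (@ae_eq_Rintegral _ _ (fun x => (v + w) x * (v + w) x))//.
- apply: le_Rintegral => //.
    by apply: (@integrableD _ _ _ leb _ mI (EFin \o (fun x => 2 * (v x * v x)))
      (EFin \o (fun x => 2 * (w x * w x)))).
  move=> x _; change ((v x + w x) * (v x + w x) <= 2 * (v x * v x) + 2 * (w x * w x)).
  by have := sqr_ge0 (v x - w x); rewrite expr2; lra.
- by apply: measurable_funM; exact: measurable_L2.
- by apply: measurable_funM; exact: measurable_L2.
- move: E; apply: filterS; first exact: (ae_filter_ringOfSetsType leb).
  by move=> x H /H ->.
Qed.

(** The Cauchy-Schwarz inequality in its linearized form 2 |v| <= t + v^2 / t,
    with the parameter t left to be chosen as the size of v. *)
Lemma L2_norm1_dist u v w t : 0 < t -> a <= b ->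
  ae (fun x => u x = v x + w x) ->
  `|\int[leb]_(x in `[a, b]) `|u x| - \int[leb]_(x in `[a, b]) `|w x| | <=
  2^-1 * (t * (b - a) + t^-1 * \int[leb]_(x in `[a, b]) (v x * v x)).
Proof.
move=> t0 ab E; have mI := measurable_itv `[a, b] : measurable (`[a, b]%classic : set (measurableTypeR R)).
have iab (z : L2 a b) : leb.-integrable `[a, b] (EFin \o (fun x => `|z x|)).
  exact: (integrable_abse (L2_integrable z)).
rewrite -(RintegralB mI (iab u) (iab w)).
have iB : leb.-integrable `[a, b] (EFin \o (fun x => `|u x| - `|w x|)).
  exact: (@integrableB _ _ _ leb _ mI _ _ (iab u) (iab w)).
apply: le_trans (le_normr_Rintegral mI iB) _.
have iv : leb.-integrable `[a, b] (EFin \o (fun x => t^-1 * (v x * v x))).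
  apply: (@integrableZl _ _ _ leb _ mI t^-1 (EFin \o (fun x => v x * v x))).
  exact: L2_mul_integrable.
have ic : leb.-integrable `[a, b] (EFin \o cst t).
  apply/integrableP; split; first exact/measurable_EFinP.
  rewrite -[X in (X < _)%E]/(\int[leb]_(x in `[a, b]) (cst `|t|%:E) x)%E.
  rewrite integral_cst//= lebesgue_measure_itv /=.
  by case: ifP => _; rewrite -?EFinB -?EFinM ?mule0 ltry.
have id : leb.-integrable `[a, b] (EFin \o (fun x => t + t^-1 * (v x * v x))).
  exact: (@integrableD _ _ _ leb _ mI _ _ ic iv).
have -> : t * (b - a) = \int[leb]_(x in `[a, b]) t.
  rewrite Rintegral_cst// [X in fine X](lebesgue_measure_itv `[a, b]) /= lte_fin.
  case: ltP => [//|ba]; have ba0 : b - a = 0 by lra.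
  by rewrite ba0.
rewrite -RintegralZl//; last exact: L2_mul_integrable.
rewrite -RintegralD// -RintegralZl//.
apply: (@le_trans _ _ (\int[leb]_(x in `[a, b]) `|v x|)).
  apply: (@le_trans _ _ (\int[leb]_(x in `[a, b]) Num.norm ((u - w) x))).
    apply: le_Rintegral => //.
    - exact: (integrable_abse iB).
    - move=> x _; change (`| `|u x| - `|w x| | <= `|u x - w x|).
      exact: ler_dist_dist.
  rewrite le_eqVlt; apply/orP; left; apply/eqP; apply: ae_eq_Rintegral => //.
  - by apply: measurableT_comp => //; exact: measurable_L2.
  - by apply: measurableT_comp => //; exact: measurable_L2.
  move: E; apply: filterS; first exact: (ae_filter_ringOfSetsType leb).
  move=> x H /H ux; change (`|u x - w x| = `|v x|).
  by rewrite ux addrK.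
apply: le_Rintegral => //.
  exact: (@integrableZl _ _ _ leb _ mI 2^-1 (EFin \o (fun x => t + t^-1 * (v x * v x)))).
move=> x _; rewrite -(ler_pM2l t0).
have -> : t * (2^-1 * (t + t^-1 * (v x * v x))) = 2^-1 * (t * t + v x * v x).
  by field; rewrite gt_eqF.
have := sqr_ge0 (t - `|v x|); rewrite sqrrB real_normK ?num_real// !expr2; lra.
Qed.

End RestrictedLebesgue.

(** * Uniqueness of weak derivatives and continuity on W *)

Section WeakDerivative.
Context {R : realType} (a b alpha : R) (psi : R -> R).
Hypothesis ab : a < b.
Hypothesis Cpsi : Cn a b (frac_order alpha) psi.
Hypothesis psim : {in `[a, b] &, {homo psi : x y / x < y}}.
Hypothesis psi'0 : forall x, x \in `[a, b] -> deriv_on a b psi x != 0.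
Local Notation leb := (@lebesgue_measure R).
Local Notation n := (frac_order alpha).
Local Notation ae P := {ae leb, forall x, `[a, b]%classic x -> P x}.

Let dpsi x : x \in `[a, b] -> derivable_on a b psi x.
Proof. by move=> xab; apply: Cn_derivable Cpsi xab. Qed.

(** The vanishing of D_psi^i at the endpoints up to i = n calls for zeros of order
    n + 1. *)
Lemma poly_test_fun (q : {poly R}) :
  test_fun a b alpha psi (fun x =>
    (('X - (psi a)%:P) ^+ n.+1 * (('X - (psi b)%:P) ^+ n.+1 * q)).[psi x]).
Proof.
split; first exact: Cn_horner.
have aab : a \in `[a, b] by rewrite in_itv /= lexx ltW.
have bab : b \in `[a, b] by rewrite in_itv /= lexx ltW.
move=> i ni; rewrite !(iter_Dpsi_horner ab dpsi psi'0)//; split.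
  exact: horner_derivn_factor.
by rewrite mulrCA; exact: horner_derivn_factor.
Qed.

(** Apply the equation to the difference of the two pairs: its left-hand side
    vanishes, so psi' (v2 - v1) W0(psi) has zero moments against all polynomials in
    psi.  The factors psi' and W0(psi) do not vanish on ]a, b[. *)
Lemma weak_riesz_unique (u1 u2 v1 v2 : L2 a b) :
  weak_riesz alpha psi u1 v1 -> weak_riesz alpha psi u2 v2 ->
  ae (fun x => u1 x = u2 x) -> ae (fun x => v1 x = v2 x).
Proof.
move=> H1 H2 u12; have mI := measurable_itv `[a, b] : measurable (`[a, b]%classic : set (measurableTypeR R)).
have H := weak_riesz_linear (-1) H1 H2.
set u := -1 *: u1 + u2 in H; set v := -1 *: v1 + v2 in H.
pose W0 : {poly R} := ('X - (psi a)%:P) ^+ n.+1 * ('X - (psi b)%:P) ^+ n.+1.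
pose F x := deriv_on a b psi x * v x * W0.[psi x].
have : {ae leb, forall x, a < x < b -> F x = 0}.
  apply: (ae_eq0_of_poly_moments ab psim) => q.
  have [iu iv E] := H _ (poly_test_fun q).
  have FE : (fun x => F x * q.[psi x]) = (fun x => deriv_on a b psi x * v x *
      (('X - (psi a)%:P) ^+ n.+1 * (('X - (psi b)%:P) ^+ n.+1 * q)).[psi x]).
    by apply/funext => x; rewrite /F /W0 !hornerM -!mulrA.
  rewrite FE; split; first exact: iv.
  have mint (f : R -> R) : leb.-integrable `[a, b] (EFin \o f) ->
      measurable_fun `[a, b] f.
    by case/integrableP => /measurable_EFinP.
  have E0 : \int[leb]_(x in `[a, b])
      (deriv_on a b psi x * u x * riesz a b alpha psi (fun x =>
      (('X - (psi a)%:P) ^+ n.+1 * (('X - (psi b)%:P) ^+ n.+1 * q)).[psi x]) x) = 0.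
    rewrite (ae_eq_Rintegral mI (mint _ iu) (g := cst 0))//.
      by rewrite Rintegral_cst// mul0r.
    move: u12; apply: filterS; first exact: (ae_filter_ringOfSetsType leb).
    move=> x Hx /Hx u12x; have -> : u x = -1 * u1 x + u2 x by [].
    by rewrite u12x mulN1r addNr mulr0 mul0r.
  move: E; rewrite E0 => /esym/eqP; rewrite mulf_eq0 signr_eq0 /= => /eqP; exact.
have ae_ne (c : R) : {ae leb, forall x, x != c}.
  exists [set c]; split => //; first exact: lebesgue_measure_set1.
  by move=> x /= /negP; rewrite negbK => /eqP.
have FF := ae_filter_ringOfSetsType leb.
move=> HF; apply: (@filterS3 _ _ FF _ _ _ _ _ HF (ae_ne a) (ae_ne b)).
move=> x Fx xa xb /= xab; move: (xab); rewrite in_itv /= => /andP[ax bx].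
have {}ax : a < x by rewrite lt_neqAle eq_sym xa.
have {}bx : x < b by rewrite lt_neqAle xb.
have aab : a \in `[a, b] by rewrite in_itv /= lexx ltW.
have bab : b \in `[a, b] by rewrite in_itv /= lexx ltW.
have pa : psi x - psi a != 0 by rewrite subr_eq0 gt_eqF// psim.
have pb : psi x - psi b != 0 by rewrite subr_eq0 lt_eqF// psim.
have w0 : W0.[psi x] != 0.
  by rewrite hornerM !horner_exp !hornerXsubC mulf_neq0// expf_neq0.
have /eqP : F x = 0 by apply: Fx; rewrite ax bx.
rewrite /F !mulf_eq0 (negbTE w0) (negbTE (psi'0 xab)) orbF /= => /eqP vx.
have : -1 * v1 x + v2 x = 0 := vx.
by rewrite mulN1r addrC => /eqP; rewrite subr_eq0 => /eqP ->.
Qed.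

Implicit Types u v : W a b alpha psi.

Lemma Driesz_weak u : weak_riesz alpha psi (Wrep_fun (Wval u)) (Driesz u).
Proof.
rewrite /Driesz; case: (Wval u) => f /= /asboolP[v Hv].
by apply: (@xgetPex _ 0 [set v | weak_riesz alpha psi f v]); exists v.
Qed.

(** Choosing representatives is additive only almost everywhere. *)
Lemma Wval_sub u v :
  ae (fun x => Wrep_fun (Wval u) x = Wrep_fun (Wval (u - v)) x + Wrep_fun (Wval v) x).
Proof.
apply: ae_leb_on.
have : Wclass (Wval (u - v) + Wval v) == Wclass (Wval u).
  by rewrite WclassD !WvalK subrK.
rewrite eq_Wclass => /asboolP; apply: filterS => x /(_ Logic.I) E.
have {}E : Wrep_fun (Wval (u - v)) x + Wrep_fun (Wval v) x - Wrep_fun (Wval u) x = 0 := E.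
by apply/esym/eqP; rewrite -subr_eq0 E.
Qed.

(** The sum of weak derivatives of u - v and v is a weak derivative of a function
    that equals u almost everywhere, so uniqueness applies. *)
Lemma Driesz_sub u v :
  ae (fun x => Driesz u x = Driesz (u - v) x + Driesz v x).
Proof.
have H := weak_riesz_linear 1 (Driesz_weak (u - v)) (Driesz_weak v).
have := weak_riesz_unique (Driesz_weak u) H.
have E x (f g : L2 a b) : (1 *: f + g) x = f x + g x.
  by rewrite scale1r.
move=> /(_ _)/wrap[|].
  move: (Wval_sub u v); apply: filterS; first exact: (ae_filter_ringOfSetsType leb).
  by move=> x Hx /Hx ->; rewrite E.
apply: filterS; first exact: (ae_filter_ringOfSetsType leb).
by move=> x Hx /Hx ->; rewrite E.
Qed.

Lemma Wdot_ge0 u : 0 <= Wdot u u.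
Proof.
by apply: addr_ge0; apply: Rintegral_ge0 => x _; rewrite -expr2 sqr_ge0.
Qed.

Lemma Wnorm_sqr u : Wnorm u ^+ 2 = Wdot u u.
Proof. by rewrite sqr_sqrtr ?Wdot_ge0. Qed.

Lemma Wdot_sub_le u v : Wdot u u <= 2 * Wdot (u - v) (u - v) + 2 * Wdot v v.
Proof.
have sum (p q r s t k : R) : p <= 2 * q + 2 * r -> s <= 2 * t + 2 * k ->
    p + s <= 2 * (q + t) + 2 * (r + k) by lra.
exact: sum (L2_sum_sqr_le (Wval_sub u v)) (L2_sum_sqr_le (Driesz_sub u v)).
Qed.

(** Continuity for the seminorm Wnorm, whose open sets generate the sigma-algebra of
    the space. *)
Definition Wcontinuous (f : W a b alpha psi -> R) := forall u (eps : R), 0 < eps ->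
  exists2 e : R, 0 < e & forall v, Wnorm (v - u) < e -> `|f v - f u| < eps.

Lemma Wcontinuous_measurable (f : W a b alpha psi -> R) :
  Wcontinuous f -> measurable_fun setT f.
Proof.
move=> cf; apply: (measurability _ (RGenOInfty.measurableE R)).
move=> /= _ [_ [c ->] <-]; rewrite setTI; apply: sub_sigma_algebra => u /=.
rewrite in_itv /= andbT => cu.
have [e e0 He] := cf u (f u - c) ltac:(by rewrite subr_gt0).
exists e => // v /He; rewrite /= in_itv /= andbT ltr_distl => /andP[+ _]; lra.
Qed.

Lemma Wcontinuous_of_lipschitz (f : W a b alpha psi -> R) :
  (forall r : R, 0 < r -> exists2 K : R, 0 < K & forall u1 u2,
     Num.max (Wnorm u1) (Wnorm u2) < r -> `|f u1 - f u2| <= K * Wnorm (u1 - u2)) ->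
  Wcontinuous f.
Proof.
move=> Lf u eps eps0.
have N0 (w : W a b alpha psi) : 0 <= Wnorm w := sqrtr_ge0 _.
(* The ball of radius r contains the unit ball around u: if |v - u| < 1 then
   |v|^2 <= 2 + 2 |u|^2 < r^2. *)
pose r := Wnorm u * 2 + 3.
have r0 : 0 < r by rewrite ltr_wpDl// mulr_ge0.
have [K K0 HK] := Lf r r0.
exists (Num.min 1 (eps / K)); first by rewrite lt_min ltr01 divr_gt0.
move=> v; rewrite lt_min => /andP[v1 vK].
apply: le_lt_trans (HK v u _) _; last by rewrite mulrC -ltr_pdivlMr.
(* The squares are passed with their values as separate variables, so that no
   elements of the quotient space have to be compared. *)
have bound (p q s P Q S : R) : p ^+ 2 = P -> q ^+ 2 = Q -> s ^+ 2 = S ->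
    S <= 2 * P + 2 * Q -> 0 <= q -> 0 <= s -> p < 1 -> 0 <= p -> s < q * 2 + 3.
  move=> <- <- <- H q0 s0 p1 p0; rewrite !expr2 in H.
  have [//|] := ltP s (q * 2 + 3); nra.
rewrite gt_max; apply/andP; split.
  exact: (bound _ _ _ _ _ _ (Wnorm_sqr (v - u)) (Wnorm_sqr u) (Wnorm_sqr v)
    (Wdot_sub_le v u)).
have qlt (q : R) : 0 <= q -> q < q * 2 + 3 by lra.
exact: qlt (N0 u).
Qed.

(** If |v - u| < e, the linearized Cauchy-Schwarz inequality with parameter e bounds
    |R(v) - R(u)| by lambda e (b - a + 1) / 2. *)
Lemma regularizer_continuous (lambda : R) : 0 < lambda ->
  Wcontinuous (regularizer lambda : W a b alpha psi -> R).
Proof.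
move=> l0 u eps eps0; have c0 : 0 < b - a + 1 by rewrite ltr_wpDl ?subr_ge0 ?ltW.
pose e := eps / (lambda * (b - a + 1)).
have e0 : 0 < e by rewrite divr_gt0 // mulr_gt0.
exists e => // v ve.
rewrite /regularizer -mulrBr normrM gtr0_norm//.
apply: (@le_lt_trans _ _ (lambda * (2^-1 * (e * (b - a + 1))))).
  rewrite ler_pM2l//; apply: le_trans (L2_norm1_dist e0 (ltW ab) (Driesz_sub v u)) _.
  have eE : e * (b - a + 1) = e * (b - a) + e by ring.
  rewrite eE ler_pM2l ?invr_gt0// lerD2l ler_pdivrMl//.
  apply: (@le_trans _ _ (Wnorm (v - u) ^+ 2)).
    rewrite Wnorm_sqr /Wdot lerDr; apply: Rintegral_ge0 => x _.
    by rewrite -expr2 sqr_ge0.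
  by rewrite -expr2 lerXn2r ?nnegrE ?sqrtr_ge0 ?ltW.
have -> : lambda * (2^-1 * (e * (b - a + 1))) = eps / 2.
  by rewrite /e; field; rewrite !gt_eqF.
lra.
Qed.

End WeakDerivative.

(** * Gibbs measures *)

Section Gibbs.
Local Open Scope charge_scope.
Context {d : measure_display} {X : measurableType d} {R : realType}.
Implicit Types (mu P Q : probability X R) (V : X -> R).

Lemma integrable_bounded mu (f : X -> R) (M : R) :
  measurable_fun setT f -> (forall x, 0 <= f x <= M) ->
  mu.-integrable setT (EFin \o f).
Proof.
move=> mf f01.
apply: (@le_integrable _ _ _ mu setT measurableT _ (EFin \o cst M)).
- exact/measurable_EFinP.
- move=> x _ /=; have /andP[f0 f1] := f01 x.
  by rewrite lee_fin !ger0_norm// (le_trans f0).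
- exact: finite_measure_integrable_cst.
Qed.

Lemma gt0_integral mu (f : X -> R) :
  measurable_fun setT f -> (forall x, 0 < f x) ->
  (0 < \int[mu]_x (f x)%:E)%E.
Proof.
move=> mf f0; rewrite lt0e integral_ge0 ?andbT; last first.
  by move=> x _; rewrite lee_fin ltW.
apply/eqP => I0.
have : (\int[mu]_x `|(f x)%:E| = 0)%E.
  by rewrite -I0; apply: eq_integral => x _; rewrite /= ger0_norm ?ltW.
have mEf : measurable_fun setT (EFin \o f) by exact/measurable_EFinP.
move/(ae_eq_integral_abs mu measurableT mEf) => [N [mN N0 sub]].
have : (mu setT <= mu N)%E.
  apply: le_measure; rewrite ?inE// => x _; apply: sub => /= /(_ I)[] /eqP.
  by rewrite gt_eqF.
by rewrite N0 probability_setT lee_fin ler10.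
Qed.

Lemma gibbs_integral mu V P : measurable_fun setT V ->
  gibbs mu V P -> exists2 c : R, 0 < c &
    (forall A, measurable A -> P A = \int[mu]_(u in A) (c * expR (- V u))%:E)%E.
Proof.
move=> mV [dom [c c0 ae]]; exists c => // A mA.
have := @Radon_Nikodym_integral _ _ _ (charge_of_finite_measure P) mu A dom mA.
rewrite /= => ->; apply: ae_eq_integral => //.
- exact: measurable_funTS.
- apply: measurable_funTS; apply/measurable_EFinP; apply: measurable_funM => //.
  by apply: measurableT_comp => //; exact: measurableT_comp.
- by apply: filterS ae => x + _; apply.
Qed.

(** The normalization constant of exp(-V). *)
Definition partition_fun mu V : R := \int[mu]_u expR (- V u).

Lemma measurable_expRN V : measurable_fun setT V ->
  measurable_fun setT (fun u => expR (- V u)).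
Proof. by move=> mV; apply: measurableT_comp => //; exact: measurableT_comp. Qed.

Lemma expRN_itv V : (forall u, 0 <= V u) -> forall u, 0 <= expR (- V u) <= 1.
Proof. by move=> V0 u; rewrite expR_ge0 -expR0 ler_expR oppr_le0 V0. Qed.

Lemma integral_expRN_bounds mu V : measurable_fun setT V -> (forall u, 0 <= V u) ->
  (0 < \int[mu]_u (expR (- V u))%:E < +oo)%E.
Proof.
move=> mV V0; have mE := measurable_expRN mV.
rewrite gt0_integral//=; last by move=> x; exact: expR_gt0.
exact: (integrable_lty measurableT (integrable_bounded mu mE (expRN_itv V0))).
Qed.

Lemma partition_funE mu V : measurable_fun setT V -> (forall u, 0 <= V u) ->
  (\int[mu]_u (expR (- V u))%:E = (partition_fun mu V)%:E)%E.
Proof.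
move=> mV V0; have /andP[I0 Ioo] := integral_expRN_bounds mu mV V0.
by rewrite /partition_fun /Rintegral fineK// gt0_fin_numE.
Qed.

Lemma partition_fun_gt0 mu V : measurable_fun setT V -> (forall u, 0 <= V u) ->
  0 < partition_fun mu V.
Proof.
move=> mV V0; have /andP[I0 Ioo] := integral_expRN_bounds mu mV V0.
by rewrite -lte_fin -partition_funE.
Qed.

(** The unknown constant of a Gibbs measure is forced by its total mass. *)
Lemma gibbs_density mu V P : measurable_fun setT V -> (forall u, 0 <= V u) ->
  gibbs mu V P ->
  (forall A, measurable A ->
    P A = \int[mu]_(u in A) ((partition_fun mu V)^-1 * expR (- V u))%:E)%E.
Proof.
move=> mV V0 gP; have [c c0 Pc] := gibbs_integral mV gP.
have Z0 := partition_fun_gt0 mu mV V0.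
suff -> : (partition_fun mu V)^-1 = c by [].
have := Pc setT measurableT; rewrite probability_setT.
under eq_integral do rewrite EFinM.
rewrite integralZl//; last exact: (integrable_bounded _ (measurable_expRN mV) (expRN_itv V0)).
rewrite partition_funE// -EFinM => -[cZ].
by rewrite -[LHS]mul1r cZ mulfK// gt_eqF.
Qed.

Lemma gibbs_unique mu V P Q : measurable_fun setT V -> (forall u, 0 <= V u) ->
  gibbs mu V P -> gibbs mu V Q -> forall A, measurable A -> Q A = P A.
Proof.
by move=> mV V0 gP gQ A mA; rewrite (gibbs_density mV V0 gP)// (gibbs_density mV V0 gQ).
Qed.

Section Existence.
Context (mu : probability X R) (V : X -> R).
Hypotheses (mV : measurable_fun setT V) (V0 : forall u, 0 <= V u).
Local Notation Z := (partition_fun mu V).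
Let f u : \bar R := (Z^-1 * expR (- V u))%:E.

Let Z0 : 0 < Z. Proof. exact: partition_fun_gt0. Qed.

Let f_ge0 u : (0 <= f u)%E.
Proof. by rewrite lee_fin mulr_ge0 ?expR_ge0// invr_ge0 ltW. Qed.

Let mf : measurable_fun setT f.
Proof. by apply/measurable_EFinP; apply: measurable_funM => //; exact: measurable_expRN. Qed.

Definition gibbs_measure (A : set X) : \bar R := (\int[mu]_(u in A) f u)%E.

Let gibbs0 : gibbs_measure set0 = 0%E. Proof. exact: integral_set0. Qed.
Let gibbs_ge0 A : (0 <= gibbs_measure A)%E. Proof. by apply: integral_ge0 => *; exact: f_ge0. Qed.
Let gibbs_sigma : semi_sigma_additive gibbs_measure.
Proof. exact: semi_sigma_additive_nng_induced mf f_ge0. Qed.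

HB.instance Definition _ := isMeasure.Build _ _ _ gibbs_measure gibbs0 gibbs_ge0 gibbs_sigma.

Let gibbs_setT : gibbs_measure setT = 1%E.
Proof.
rewrite /gibbs_measure /f; under eq_integral do rewrite EFinM.
rewrite integralZl//; last exact: (integrable_bounded _ (measurable_expRN mV) (expRN_itv V0)).
by rewrite partition_funE// -EFinM mulVf// gt_eqF.
Qed.

HB.instance Definition _ := Measure_isProbability.Build _ _ _ gibbs_measure gibbs_setT.

Lemma gibbs_exists : exists P : probability X R, gibbs mu V P.
Proof.
pose P : probability X R := gibbs_measure.
have dom : P `<< mu.
  apply/null_content_dominatesP => A mA A0.
  by rewrite /P /= /gibbs_measure null_set_integral //; exact: measurable_funTS.
exists P; split => //; exists Z^-1; first by rewrite invr_gt0.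
have : ae_eq mu setT ('d (charge_of_finite_measure P) '/d mu) f.
  apply: integral_ae_eq => //.
  - exact: Radon_Nikodym_integrable.
  - by move=> E _ mE; rewrite -Radon_Nikodym_integral.
by apply: filterS => x + _; exact.
Qed.

End Existence.
End Gibbs.

Lemma le_partition_fun {d} {X : measurableType d} {R : realType}
    (mu : probability X R) (V W : X -> R) :
  measurable_fun setT V -> (forall u, 0 <= V u) ->
  measurable_fun setT W -> (forall u, V u <= W u) ->
  partition_fun mu W <= partition_fun mu V.
Proof.
move=> mV V0 mW VW; have W0 u : 0 <= W u by apply: le_trans (VW u).
apply: le_Rintegral => //.
- exact: integrable_bounded (measurable_expRN mW) (expRN_itv W0).
- exact: integrable_bounded (measurable_expRN mV) (expRN_itv V0).
- by move=> u _; rewrite ler_expR lerN2.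
Qed.

(** * Hellinger distance between Gibbs measures *)

Section Hellinger.
Local Open Scope charge_scope.
Context {d : measure_display} {X : measurableType d} {R : realType}.
Implicit Types (mu P Q : probability X R) (V : X -> R).

(** A positive density has a null integral only over null sets. *)
Lemma gibbs_dominates mu V P : measurable_fun setT V -> (forall u, 0 <= V u) ->
  gibbs mu V P -> mu `<< P.
Proof.
move=> mV V0 gP; apply/null_content_dominatesP => A mA PA0.
have := gibbs_density mV V0 gP mA; rewrite PA0 => /esym.
have Z0 := partition_fun_gt0 mu mV V0.
have f0 u : 0 < (partition_fun mu V)^-1 * expR (- V u).
  by rewrite mulr_gt0 ?expR_gt0// invr_gt0.
rewrite -[X in X = _ -> _](@eq_integral _ _ _ mu A _
  (fun u => `|((partition_fun mu V)^-1 * expR (- V u))%:E|%E)); last first.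
  by move=> u _; rewrite /= ger0_norm// ltW.
move/ae_eq_integral_abs => [//||N [mN N0 sub]].
  apply: measurable_funTS; apply/measurable_EFinP; apply: measurable_funM => //.
  exact: measurable_expRN.
apply: (subset_measure0 mA mN _ N0) => x Ax; apply: sub => /= /(_ Ax)[] /eqP.
by rewrite gt_eqF.
Qed.

(** The everywhere nonnegative version of d mu / d nu is used, so that square roots
    of the product split. *)
Lemma gibbs_density_dominating mu V P (nu : {sigma_finite_measure set X -> \bar R}) :
  measurable_fun setT V -> (forall u, 0 <= V u) ->
  gibbs mu V P -> P `<< nu -> mu `<< nu ->
  {ae nu, forall u, ('d (charge_of_finite_measure P) '/d nu) u =
     (((partition_fun mu V)^-1 * expR (- V u))%:E *
     Radon_Nikodym_SigmaFinite.f mu nu u)%E}.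
Proof.
move=> mV V0 gP Pnu munu.
have Z0 := partition_fun_gt0 mu mV V0.
have mE := measurable_expRN mV.
have mh := measurable_int _ (Radon_Nikodym_SigmaFinite.f_integrable munu).
have mfh : measurable_fun setT (fun u => ((partition_fun mu V)^-1 * expR (- V u))%:E *
     Radon_Nikodym_SigmaFinite.f mu nu u)%E.
  apply: emeasurable_funM => //; apply/measurable_EFinP.
  exact: measurable_funM.
have : ae_eq nu setT ('d (charge_of_finite_measure P) '/d nu)
    (fun u => ((partition_fun mu V)^-1 * expR (- V u))%:E *
     Radon_Nikodym_SigmaFinite.f mu nu u)%E.
  apply: integral_ae_eq => //.
  - exact: Radon_Nikodym_integrable.
  - move=> E _ mEE; rewrite -Radon_Nikodym_integral//= (gibbs_density mV V0 gP)//.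
    rewrite Radon_Nikodym_SigmaFinite.change_of_variables//.
    + by move=> u; rewrite lee_fin mulr_ge0 ?expR_ge0// invr_ge0 ltW.
    + apply: measurable_funTS; apply/measurable_EFinP; exact: measurable_funM.
by apply: filterS => u + ; exact.
Qed.

(** With s = sqrt Z, s' = sqrt Z', e = exp(-V / 2) and e' = exp(-V' / 2) <= 1,
    e / s - e' / s' = (e - e') / s + e' (s' - s) / (s s').
    The first term is at most delta / sqrt z.  Moreover
    |Z' - Z| <= 2 delta, since |e'^2 - e^2| <= 2 |e' - e|, whence
    |s' - s| = |Z' - Z| / (s + s') <= delta / sqrt z. *)
Lemma sqrt_partition_dist mu V V' (delta z : R) :
  measurable_fun setT V -> (forall u, 0 <= V u) ->
  measurable_fun setT V' -> (forall u, 0 <= V' u) ->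
  (forall u, `|expR (- V u / 2) - expR (- V' u / 2)| <= delta) ->
  0 < z -> z <= partition_fun mu V -> z <= partition_fun mu V' ->
  forall u, `|Num.sqrt ((partition_fun mu V)^-1 * expR (- V u)) -
     Num.sqrt ((partition_fun mu V')^-1 * expR (- V' u))| <=
  ((Num.sqrt z)^-1 + (Num.sqrt z) ^- 3) * delta.
Proof.
move=> mV V0 mV' V0' Hd z0 zZ zZ' u.
set Z := partition_fun mu V in zZ *; set Z' := partition_fun mu V' in zZ' *.
have Z0 : 0 < Z by exact: partition_fun_gt0.
have Z0' : 0 < Z' by exact: partition_fun_gt0.
have half (W : R) : expR (- W) = expR (- W / 2) ^+ 2 by rewrite -expRM_natl; congr expR; field.
have sq W (w : R) : 0 < w -> Num.sqrt (w^-1 * expR (- W)) = (Num.sqrt w)^-1 * expR (- W / 2).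
  move=> w0; rewrite sqrtrM ?invr_ge0 ?ltW// half sqrtr_sqr ger0_norm ?expR_ge0//.
  by rewrite sqrtrV// ltW.
rewrite !sq//.
have e01 (W : R) : 0 <= W -> 0 <= expR (- W / 2) <= 1.
  by move=> W0; rewrite expR_ge0 -[leRHS]expR0 ler_expR; lra.
have ZZ : `|Z' - Z| <= 2 * delta.
  have iV : mu.-integrable setT (EFin \o (fun u => expR (- V u))).
    exact: integrable_bounded (measurable_expRN mV) (expRN_itv V0).
  have iV' : mu.-integrable setT (EFin \o (fun u => expR (- V' u))).
    exact: integrable_bounded (measurable_expRN mV') (expRN_itv V0').
  rewrite /Z /Z' /partition_fun -RintegralB//.
  have iB : mu.-integrable setT (EFin \o (fun u => expR (- V' u) - expR (- V u))).
    exact: (@integrableB _ _ _ mu setT measurableT _ _ iV' iV).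
  apply: le_trans (le_normr_Rintegral measurableT iB) _.
  apply: (@le_trans _ _ (\int[mu]_u (2 * delta))); last first.
    by rewrite Rintegral_cst// [X in fine X](probability_setT mu) mulr1.
  apply: le_Rintegral => //.
  - exact: (integrable_abse iB).
  - exact: finite_measure_integrable_cst.
  move=> x _; rewrite !half subr_sqr normrM distrC mulrC.
  have /andP[a0 a1] := e01 _ (V0 x); have /andP[b0 b1] := e01 _ (V0' x).
  apply: ler_pM => //; rewrite ger0_norm; lra.
clearbody Z Z'.
set r := Num.sqrt z; set s := Num.sqrt Z; set s' := Num.sqrt Z'.
have r0 : 0 < r by rewrite sqrtr_gt0.
have rs : r <= s by exact: ler_wsqrtr.
have rs' : r <= s' by exact: ler_wsqrtr.
have s0 : 0 < s by lra.
have s0' : 0 < s' by lra.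
have d0 : 0 <= delta by apply: le_trans (Hd u).
have sd : `|s' - s| <= delta / r.
  have : `|s' - s| * (s' + s) <= 2 * delta.
    have E : s' + s = `|s' + s| by rewrite gtr0_norm// addr_gt0.
    rewrite [X in _ * X]E -normrM -subr_sqr.
    by rewrite (sqr_sqrtr (ltW Z0)) (sqr_sqrtr (ltW Z0')).
  rewrite ler_pdivlMr// => H; have := normr_ge0 (s' - s); nra.
have /andP[b0 b1] := e01 _ (V0' u).
have -> : s^-1 * expR (- V u / 2) - s'^-1 * expR (- V' u / 2) =
  s^-1 * (expR (- V u / 2) - expR (- V' u / 2)) +
  expR (- V' u / 2) * ((s' - s) * (s^-1 * s'^-1)).
  field; rewrite !gt_eqF //.
apply: le_trans (ler_normD _ _) _; rewrite [leRHS]mulrDl.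
have si : s^-1 <= r^-1 by rewrite lef_pV2 ?posrE.
have si' : s'^-1 <= r^-1 by rewrite lef_pV2 ?posrE.
have vi : 0 < s^-1 by rewrite invr_gt0.
have vi' : 0 < s'^-1 by rewrite invr_gt0.
apply: lerD.
  rewrite normrM gtr0_norm//; apply: ler_pM => //; exact: ltW.
rewrite normrM ger0_norm// normrM [X in _ * (_ * X)]gtr0_norm ?mulr_gt0//.
apply: (@le_trans _ _ (1 * (delta / r * (r^-1 * r^-1)))).
  apply: ler_pM => //; first by rewrite mulr_ge0 // mulr_ge0 // ltW.
  apply: ler_pM => //; first by rewrite mulr_ge0 // ltW.
  by apply: ler_pM => //; exact: ltW.
rewrite le_eqVlt; apply/orP; left; apply/eqP; field; rewrite ?gt_eqF//.
Qed.

(** With h = d mu / d nu, the integrand of the Hellinger distance is at most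
    K^2 h, and h has integral mu(X) = 1. *)
Lemma hellinger_gibbs_le mu V V' P P' (delta z : R)
    (nu : {sigma_finite_measure set X -> \bar R}) :
  measurable_fun setT V -> (forall u, 0 <= V u) ->
  measurable_fun setT V' -> (forall u, 0 <= V' u) ->
  (forall u, `|expR (- V u / 2) - expR (- V' u / 2)| <= delta) ->
  0 < z -> z <= partition_fun mu V -> z <= partition_fun mu V' ->
  gibbs mu V P -> gibbs mu V' P' -> P `<< nu -> P' `<< nu ->
  hellinger nu P P' <= ((Num.sqrt z)^-1 + (Num.sqrt z) ^- 3) * delta.
Proof.
move=> mV V0 mV' V0' Hd z0 zZ zZ' gP gP' Pnu Pnu'.
set K := (_ * delta).
have munu : mu `<< nu := null_dominates_trans (gibbs_dominates mV V0 gP) Pnu.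
have dist := sqrt_partition_dist mV V0 mV' V0' Hd z0 zZ zZ'.
have K0 : 0 <= K by apply: le_trans (dist point).
pose h := Radon_Nikodym_SigmaFinite.f mu nu.
have h0 u : (0 <= h u)%E := Radon_Nikodym_SigmaFinite.f_ge0 munu u.
have hfin u : h u \is a fin_num := Radon_Nikodym_SigmaFinite.f_fin_num munu u.
have hint := Radon_Nikodym_SigmaFinite.f_integrable munu.
have mh : measurable_fun setT h := measurable_int _ hint.
rewrite /hellinger -(ger0_norm K0) -sqrtr_sqr; apply: ler_wsqrtr.
set g := fun u => _ ^+ 2.
have msqrt_dens Q : Q `<< nu -> measurable_fun setT
    (fun u => Num.sqrt (fine (('d (charge_of_finite_measure Q) '/d nu) u))).
  move=> Qnu; apply: measurableT_comp.
    by apply: continuous_measurable_fun; exact: sqrt_continuous.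
  apply: measurableT_comp; first exact: fine_measurable.
  by apply: measurable_int; exact: Radon_Nikodym_integrable.
have Ig : (\int[nu]_u (g u)%:E <= (K ^+ 2)%:E)%E.
  apply: (@le_trans _ _ (\int[nu]_u ((K ^+ 2)%:E * h u))%E); last first.
    rewrite integralZl// -[X in (_ * X)%E](Radon_Nikodym_SigmaFinite.f_integral munu measurableT).
    by rewrite [X in (_ * X)%E](probability_setT mu) mule1.
  apply: ae_ge0_le_integral => //.
  - by move=> u _; rewrite lee_fin sqr_ge0.
  - apply/measurable_EFinP; apply: measurable_funX; apply: measurable_funB.
      exact: msqrt_dens.
    exact: msqrt_dens.
  - by move=> u _; rewrite mule_ge0// lee_fin sqr_ge0.
  - exact: emeasurable_funM.
  have aeP := gibbs_density_dominating mV V0 gP Pnu munu.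
  have aeP' := gibbs_density_dominating mV' V0' gP' Pnu' munu.
  apply: filterS2 aeP aeP' => u Eu Eu' _.
  rewrite /g Eu Eu' -/h -(fineK (hfin u)) -!EFinM lee_fin /=.
  have hu0 : 0 <= fine (h u) by exact: fine_ge0.
  have dens0 (W : X -> R) : measurable_fun setT W -> (forall u, 0 <= W u) ->
      0 <= (partition_fun mu W)^-1 * expR (- W u).
    by move=> mW W0; rewrite mulr_ge0 ?expR_ge0 ?invr_ge0 ?ltW ?partition_fun_gt0.
  rewrite (sqrtrM _ (dens0 _ mV V0)) (sqrtrM _ (dens0 _ mV' V0')).
  rewrite -mulrBl exprMn sqr_sqrtr//; apply: ler_wpM2r => //.
  by rewrite -[leLHS]real_normK ?num_real// lerXn2r ?nnegrE// dist.
have Ig0 : (0 <= \int[nu]_u (g u)%:E)%E.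
  by apply: integral_ge0 => u _; rewrite lee_fin sqr_ge0.
have : \int[nu]_u g u <= K ^+ 2.
  rewrite /Rintegral -[leRHS]/(fine (K ^+ 2)%:E) fine_le//.
  by rewrite ge0_fin_numE// (le_lt_trans Ig)// ltry.
have : 0 <= \int[nu]_u g u by apply: fine_ge0.
lra.
Qed.

End Hellinger.

(** * Norms of observations and the half-Gaussian profile *)

Section Norms.
Context {R : realType} {m : nat}.
Implicit Types (z w : 'cV[R]_m) (Sigma : 'M[R]_m).

Lemma norm2_ge0 z : 0 <= norm2 z. Proof. exact: sqrtr_ge0. Qed.

Lemma norm2_sqr z : norm2 z ^+ 2 = \sum_i z i 0 ^+ 2.
Proof. by rewrite sqr_sqrtr// sumr_ge0// => i _; exact: sqr_ge0. Qed.

(** Cauchy-Schwarz, by Lagrange's identity: |z|^2 |w|^2 - (z . w)^2 is half of the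
    sum of the (z_i w_j - z_j w_i)^2 over all i and j. *)
Lemma norm2_dot_le z w : \sum_i z i 0 * w i 0 <= norm2 z * norm2 w.
Proof.
apply: le_trans (ler_norm _) _.
rewrite -(ler_pXn2r (ltn0Sn 1)) ?nnegrE ?mulr_ge0 ?norm2_ge0//.
rewrite real_normK ?num_real// exprMn !norm2_sqr -subr_ge0.
set A := \sum_i z i 0 ^+ 2; set B := \sum_i w i 0 ^+ 2; set C := \sum_i _.
have L : \sum_i \sum_j (z i 0 * w j 0 - z j 0 * w i 0) ^+ 2 = 2 * (A * B - C ^+ 2).
  transitivity (\sum_i (z i 0 ^+ 2 * B - 2 * (z i 0 * w i 0) * C + w i 0 ^+ 2 * A)).
    apply: eq_bigr => i _; rewrite /A /B /C !mulr_sumr -sumrN -!big_split /=.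
    by apply: eq_bigr => j _; ring.
  rewrite !big_split /= sumrN -!mulr_suml -mulr_sumr -/A -/B -/C; ring.
have : 0 <= \sum_i \sum_j (z i 0 * w j 0 - z j 0 * w i 0) ^+ 2.
  by apply: sumr_ge0 => i _; apply: sumr_ge0 => j _; exact: sqr_ge0.
by rewrite L pmulr_rge0.
Qed.

Lemma norm2D z w : norm2 (z + w) <= norm2 z + norm2 w.
Proof.
rewrite -(ler_pXn2r (ltn0Sn 1)) ?nnegrE ?addr_ge0 ?norm2_ge0//.
have -> : norm2 (z + w) ^+ 2 = norm2 z ^+ 2 + 2 * (\sum_i z i 0 * w i 0) + norm2 w ^+ 2.
  rewrite !norm2_sqr mulr_sumr -!big_split /=; apply: eq_bigr => i _.
  by rewrite !mxE; ring.
have := norm2_dot_le z w; rewrite sqrrD -mulr_natl; lra.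
Qed.

Lemma norm2N z : norm2 (- z) = norm2 z.
Proof. by congr Num.sqrt; apply: eq_bigr => i _; rewrite mxE sqrrN. Qed.

Lemma normS_ge0 Sigma z : 0 <= normS Sigma z. Proof. exact: norm2_ge0. Qed.

Lemma normSD Sigma z w : normS Sigma (z + w) <= normS Sigma z + normS Sigma w.
Proof. by rewrite /normS mulmxDr norm2D. Qed.

Lemma normSN Sigma z : normS Sigma (- z) = normS Sigma z.
Proof. by rewrite /normS mulmxN norm2N. Qed.

Lemma normS_dist Sigma z w : `|normS Sigma z - normS Sigma w| <= normS Sigma (z - w).
Proof.
rewrite ler_norml; apply/andP; split.
  by have := normSD Sigma (w - z) z; rewrite subrK -[w - z]opprB normSN; lra.
by have := normSD Sigma (z - w) w; rewrite subrK; lra.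
Qed.

End Norms.

Section HalfGaussian.
Context {R : realType}.
Implicit Types s t k : R.

(** With x and y the exponents such that the two terms are E = exp(-x) and
    E exp(-y), the difference is at most E y = (s - t) E (s + t) / 4.  If s - t < 1,
    then (s + t) / 4 <= 1 + t^2 / 4 <= exp(x) = 1 / E, whereas for s - t >= 1 the
    bound E <= 1 suffices. *)
Lemma half_gaussian_le s t k : 0 <= k -> 0 <= t -> t <= s ->
  expR (- (2^-1 * t ^+ 2 + k) / 2) - expR (- (2^-1 * s ^+ 2 + k) / 2) <= s - t.
Proof.
move=> k0 t0 ts; set x := 2^-1 * (2^-1 * t ^+ 2 + k).
set y := 2^-1 * (2^-1 * (s ^+ 2 - t ^+ 2)).
have -> : - (2^-1 * t ^+ 2 + k) / 2 = - x by rewrite /x; field.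
have -> : - (2^-1 * s ^+ 2 + k) / 2 = - x - y by rewrite /x /y; field.
rewrite expRD; set E := expR (- x).
have E0 : 0 < E := expR_gt0 _.
have Ex : E * expR x = 1 by rewrite /E -expRD addNr expR0.
have x1 : 1 + x <= expR x := expR_ge1Dx x.
have y1 : 1 - y <= expR (- y) := expR_ge1Dx (- y).
have y0 : 0 <= expR (- y) := expR_ge0 _.
have xt : 2^-1 * (2^-1 * (t * t)) <= x by rewrite /x expr2; lra.
have Et : E * (1 + 2^-1 * (2^-1 * (t * t))) <= 1.
  by rewrite -[leRHS]Ex ler_pM2l//; lra.
have E1 : E <= 1.
  by rewrite -[leRHS]expR0 ler_expR oppr_le0; have := mulr_ge0 t0 t0; lra.
have Ey : E - E * expR (- y) <= E * y.
  have : E * (1 - y) <= E * expR (- y) by rewrite ler_pM2l.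
  by rewrite mulrBr mulr1; lra.
have [st1|st1] := leP 1 (s - t).
  by have := mulr_ge0 (ltW E0) y0; lra.
have yE : y = (s - t) * (2^-1 * (2^-1 * (s + t))) by rewrite /y; ring.
apply: le_trans Ey _; rewrite yE mulrCA ler_piMr ?subr_ge0//.
apply: le_trans Et; rewrite ler_pM2l//.
have := sqr_ge0 (t - 1); rewrite expr2; lra.
Qed.

Lemma half_gaussian_lipschitz s t k : 0 <= k -> 0 <= s -> 0 <= t ->
  `|expR (- (2^-1 * s ^+ 2 + k) / 2) - expR (- (2^-1 * t ^+ 2 + k) / 2)| <= `|s - t|.
Proof.
move=> k0; have mono (p q : R) : 0 <= p -> p <= q ->
    expR (- (2^-1 * q ^+ 2 + k) / 2) <= expR (- (2^-1 * p ^+ 2 + k) / 2).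
  move=> p0 pq; rewrite ler_expR.
  have : p ^+ 2 <= q ^+ 2 by rewrite lerXn2r ?nnegrE// (le_trans p0).
  lra.
have dist (p q : R) : 0 <= p -> p <= q ->
    `|expR (- (2^-1 * p ^+ 2 + k) / 2) - expR (- (2^-1 * q ^+ 2 + k) / 2)| <= `|q - p|.
  move=> p0 pq; rewrite ger0_norm ?subr_ge0 ?mono// ger0_norm ?subr_ge0//.
  exact: half_gaussian_le.
move=> s0 t0; have [st|/ltW ts] := leP s t; last by rewrite distrC dist.
by rewrite [leRHS]distrC dist.
Qed.

End HalfGaussian.

(** * Well-posedness and stability of the posterior *)

Theorem theorem3p5 (R : realType) (a b alpha : R) (psi : R -> R) (m : nat)
    (Sigma : 'M[R]_m)
    (mu0 : probability (W a b alpha psi) R)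
    (C0 : {linear W a b alpha psi -> W a b alpha psi})
    (G : W a b alpha psi -> 'cV[R]_m) (lambda : R) :
  a < b -> 0 < alpha ->
  Cn a b (frac_order alpha) psi ->
  {in `[a, b] &, {homo psi : x y / x < y}} ->
  (forall x, x \in `[a, b] -> deriv_on a b psi x != 0) ->
  sym_posdef Sigma ->
  bounded_op C0 -> symmetric_op C0 -> positive_op C0 -> trace_class C0 ->
  centered_gaussian mu0 C0 ->
  (forall eps : R, 0 < eps -> exists M : R, forall u,
     normS Sigma (G u) <= expR (eps * Wnorm u ^+ 2 + M)) ->
  (forall r : R, 0 < r -> exists2 K : R, 0 < K & forall u1 u2,
     Num.max (Wnorm u1) (Wnorm u2) < r ->
     normS Sigma (G u1 - G u2) <= K * Wnorm (u1 - u2)) ->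
  0 < lambda ->
  let potential y u := misfit Sigma G y u + regularizer lambda u in
  (forall y,
     [/\ measurable_fun setT (fun u => expR (- potential y u)),
         (0 < \int[mu0]_u (expR (- potential y u))%:E < +oo)%E &
         exists2 P : probability (W a b alpha psi) R,
           gibbs mu0 (potential y) P &
           forall Q : probability (W a b alpha psi) R,
             gibbs mu0 (potential y) Q ->
             forall A, measurable A -> Q A = P A]) /\
  (forall r : R, 0 < r -> exists2 C : R, 0 < C &
     forall (y y' : 'cV[R]_m) (P P' : probability (W a b alpha psi) R),
       Num.max (normS Sigma y) (normS Sigma y') < r ->
       gibbs mu0 (potential y) P -> gibbs mu0 (potential y') P' ->
       forall nu : {sigma_finite_measure set (W a b alpha psi) -> \bar R},
         P `<< nu -> P' `<< nu ->
         hellinger nu P P' <= C * normS Sigma (y - y')).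
Proof.
move=> ab _ Cpsi psim psi'0 _ _ _ _ _ _ _ A2 lambda0 potential.
have mnorm y : measurable_fun setT (fun u => normS Sigma (G u - y)).
  apply: Wcontinuous_measurable; apply: (Wcontinuous_of_lipschitz ab Cpsi psim psi'0) => r r0.
  have [K K0 HK] := A2 r r0; exists K => // u1 u2 u12.
  apply: le_trans (HK u1 u2 u12); apply: le_trans (normS_dist _ _ _) _.
  by rewrite opprB addrA subrK.
have mreg : measurable_fun setT (regularizer lambda : W a b alpha psi -> R).
  by apply: Wcontinuous_measurable; apply: regularizer_continuous.
have reg0 (u : W a b alpha psi) : 0 <= regularizer lambda u.
  by rewrite mulr_ge0 ?(ltW lambda0)//; apply: Rintegral_ge0.
have mpot y : measurable_fun setT (potential y).
  apply: measurable_funD => //; apply: measurable_funM => //.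
  exact: measurable_funX.
have pot0 y u : 0 <= potential y u.
  by rewrite addr_ge0// mulr_ge0// sqr_ge0.
split=> [y|r r0].
  split; first exact: measurable_expRN.
    exact: integral_expRN_bounds.
  have [P gP] := gibbs_exists mu0 (mpot y) (pot0 y).
  by exists P => // Q gQ A mA; exact: gibbs_unique gP gQ A mA.
(* Vr dominates all potentials with |y| < r, so its partition function bounds
   theirs from below. *)
pose Vr u := normS Sigma (G u) ^+ 2 + r ^+ 2 + regularizer lambda u.
have mVr : measurable_fun setT Vr.
  apply: measurable_funD => //; apply: measurable_funD => //.
  by apply: measurable_funX; have := mnorm 0; under eq_fun do rewrite subr0.
have potVr y u : normS Sigma y < r -> potential y u <= Vr u.
  move=> yr; rewrite lerD2r /misfit.
  have := normSD Sigma (G u) (- y); rewrite normSN.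
  have := normS_ge0 Sigma (G u - y); have := normS_ge0 Sigma (G u).
  have := normS_ge0 Sigma y.
  move: (normS Sigma y) (normS Sigma (G u)) (normS Sigma (G u - y)) yr.
  move=> p q s pr p0 q0 s0 sqp; rewrite !expr2.
  have : s * s <= (q + r) * (q + r) by apply: ler_pM => //; lra.
  have := sqr_ge0 (q - r); rewrite expr2; lra.
have Vr0 u : 0 <= Vr u by rewrite !addr_ge0 ?sqr_ge0.
pose z := partition_fun mu0 Vr.
have z0 : 0 < z by exact: partition_fun_gt0.
exists ((Num.sqrt z)^-1 + (Num.sqrt z) ^- 3).
  by rewrite addr_gt0// invr_gt0 ?exprn_gt0// sqrtr_gt0.
move=> y y' P P'; rewrite gt_max => /andP[yr yr'] gP gP' nu Pnu Pnu'.
apply: (hellinger_gibbs_le (mpot y) (pot0 y) (mpot y') (pot0 y') _ z0 _ _ gP gP' Pnu Pnu').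
- move=> u; apply: le_trans (half_gaussian_lipschitz (reg0 u) (normS_ge0 _ _) (normS_ge0 _ _)) _.
  apply: le_trans (normS_dist _ _ _) _.
  by rewrite -[leRHS]normSN !(opprD, opprK) addrACA subrr add0r.
- by apply: le_partition_fun => // u; exact: potVr.
- by apply: le_partition_fun => // u; exact: potVr.
Qed.
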